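(* Work over a field of characteristic $0$. Let $(\mathbb A,r)$ be a pair of a quasi-twilled associative algebra $\mathbb A$ with a fixed decomposition $\mathbb A=A\oplus B$ and a weak deformation map $r:B\to A$ in it, and let $\Omega\in\mathscr Q_1$ be the multiplication of $\mathbb A$. Let $(\mathscr Q[1]\oplus\mathfrak b,\{\widetilde l_k\}_{k=1}^\infty)$ be the $L_\infty$-algebra described in the context. Then $(\mathscr Q[1]\oplus\mathfrak b,\{\widetilde l_k^{(\Omega[1],r)}\}_{k=1}^\infty)$ is an $L_\infty$-algebra, where $$\widetilde l_k^{(\Omega[1],r)}\big((F_1[1],f_1),\ldots,(F_k[1],f_k)\big):=\sum_{n=0}^\infty\frac1{n!}\,\widetilde l_{n+k}\big(\underbrace{(\Omega[1],r),\ldots,(\Omega[1],r)}_{n\text{ times}},(F_1[1],f_1),\ldots,(F_k[1],f_k)\big)$$ for $k\ge1$ and homogeneous $(F_1[1],f_1),\ldots,(F_k[1],f_k)\in\mathscr Q[1]\oplus\mathfrak b$. Moreover, for any other element $\Omega'\in\mathscr Q_1$ and linear map $r':B\to A$, the sum $\Omega+\Omega'\in\mathscr Q_1$ represents a quasi-twilled associative algebra structure on $A\oplus B$ and $r+r':B\to A$ is a weak deformation map in this structure if and only if $(\Omega'[1],r')\in(\mathscr Q[1]\oplus\mathfrak b)_0$ is a Maurer-Cartan element of $(\mathscr Q[1]\oplus\mathfrak b,\{\widetilde l_k^{(\Omega[1],r)}\}_{k=1}^\infty)$.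
   Context: A quasi-twilled associative algebra is an associative algebra with a fixed decomposition $\mathbb A=A\oplus B$ such that $B$ is a subalgebra. Its multiplication has the form $\Omega((a,x),(b,y))=(a\cdot_A b+a\leftharpoonup y+x\rightharpoonup b,\ x\cdot_B y+a\vartriangleright y+x\vartriangleleft b+\theta(a,b))$ for unique bilinear maps $\cdot_A:A\times A\to A$, $\cdot_B:B\times B\to B$, $\vartriangleright:A\times B\to B$, $\vartriangleleft:B\times A\to B$, $\rightharpoonup:B\times A\to A$, $\leftharpoonup:A\times B\to A$, $\theta:A\times A\to B$; elements of $\mathscr Q_1$ (below) are exactly the bilinear maps of this form, and such an element represents a quasi-twilled associative algebra structure if it is associative. A weak deformation map is a linear map $r:B\to A$ with $r(x)\cdot_A r(y)+r(x)\leftharpoonup y+x\rightharpoonup r(y)=r\big(x\cdot_B y+r(x)\vartriangleright y+x\vartriangleleft r(y)+\theta(r(x),r(y))\big)$ for all $x,y\in B$. Let $\mathfrak g=\bigoplus_{n\ge0}\mathfrak g_n$, $\mathfrak g_n=\mathrm{Hom}((A\oplus B)^{\otimes n+1},A\oplus B)$, with the Gerstenhaber bracket: for $f$ with $m$ inputs and $g$ with $n$ inputs, $[f,g]=f\diamond g-(-1)^{(m-1)(n-1)}g\diamond f$, where $(f\diamond g)(v_1,\ldots,v_{m+n-1})=\sum_{i=1}^m(-1)^{(i-1)(n-1)}f(v_1,\ldots,v_{i-1},g(v_i,\ldots,v_{i+n-1}),v_{i+n},\ldots,v_{m+n-1})$. Let $\mathfrak b=\bigoplus_{n\ge0}\mathfrak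 b_n$, $\mathfrak b_n=\mathrm{Hom}(B^{\otimes n+1},A)\subset\mathfrak g_n$ (extension by zero), and $P:\mathfrak g\to\mathfrak b$ the projection: $P(F)$ is the $A$-component of $F|_{B^{\otimes n+1}}$ for $F\in\mathfrak g_n$. Let $\mathcal A^{k,l}$ be the direct sum of all $(k+l)$-fold tensor products with $k$ factors $A$ and $l$ factors $B$. For $k,l\ge-1$, $k+l=n$, $C^{k|l}\subset\mathfrak g_n$ is the space of $f$ with $f(\mathcal A^{k+1,l})\subset A$, $f(\mathcal A^{k,l+1})\subset B$, $f=0$ on other components. Put $\mathscr Q_n=C^{n+1|-1}\oplus C^{n|0}\oplus\cdots\oplus C^{0|n}$; $\mathscr Q=\bigoplus_{n\ge0}\mathscr Q_n$ is a graded Lie subalgebra of $\mathfrak g$. Write $(\mathscr Q[1])_n=\mathscr Q_{n+1}$, $F[1]$ for $F\in\mathscr Q$ viewed in $\mathscr Q[1]$. The $L_\infty$-structure on $\mathscr Q[1]\oplus\mathfrak b$ has operations $\widetilde l_2(F[1],G[1])=(-1)^{|F|}[F,G][1]$ ($|F|$ the degree of $F$ in $\mathscr Q$) and $\widetilde l_k(F[1],f_1,\ldots,f_{k-1})=P[\cdots[[F,f_1],f_2],\ldots,f_{k-1}]$ for $k\ge2$, with $F,G\in\mathscr Q$, $f_i\in\mathfrak b$ homogeneous; up to permutation of entries all other components vanish. An $L_\infty$-algebra is a graded vector space $\mathcal G$ with graded symmetric (with Koszul sign $\epsilon(\sigma)$) degree $1$ maps $l_k:\mathcal G^{\otimes k}\to\mathcal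 G$, $k\ge1$, such that for all $N\ge1$: $\sum_{i=1}^N\sum_{\sigma\in Sh(i,N-i)}\epsilon(\sigma)\,l_{N-i+1}(l_i(x_{\sigma(1)},\ldots,x_{\sigma(i)}),x_{\sigma(i+1)},\ldots,x_{\sigma(N)})=0$ ($Sh(i,N-i)$ the $(i,N-i)$-shuffles). A Maurer-Cartan element is $\alpha\in\mathcal G_0$ with $\sum_{k\ge1}\frac1{k!}l_k(\alpha,\ldots,\alpha)=0$. All sums occurring here have finitely many nonzero terms. *)

(* Defs.v *)
From HB Require Import structures.
From mathcomp Require Import all_boot all_order all_algebra perm.
From mathcomp Require Import boolp classical_sets functions fsbigop.

Set Implicit Arguments.
Unset Strict Implicit.
Unset Printing Implicit Defensive.

Import GRing.Theory.

Local Open Scope classical_set_scope.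
Local Open Scope ring_scope.

(* A graded vector space is given by its homogeneous components
   G d (d : int), independent subspaces of an ambient space M; it stands for
   the direct sum of the G d.  A homogeneous element is carried together with
   its degree, as a pair (d, x) with x in G d; the degree is needed to compute
   signs.  A family of graded multilinear operations (l_k) on G is a function
   on lists of such pairs, l_k being its restriction to lists of size k. *)
Section Linfty.
Variables (K : fieldType) (M : lmodType K).
Implicit Types (G : int -> set M) (l : seq (int * M) -> M).

Definition graded_space G : Prop :=
  [/\ forall d, G d 0,
      forall d (a : K) x y, G d x -> G d y -> G d (a *: x + y)
    & forall (D : seq int) (x : int -> M), uniq D ->
        (forall d, d \in D -> G d (x d)) -> \sum_(d <- D) x d = 0 ->
        forall d, d \in D -> x d = 0].

Definition homogeneous G (s : seq (int * M)) : Prop :=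
  forall p, p \in s -> G p.1 p.2.

Definition degree (s : seq (int * M)) : int := \sum_(p <- s) p.1.

(* (x_1, ..., x_N) |-> (x_sigma(1), ..., x_sigma(N)) *)
Definition permute N (s : N.-tuple (int * M)) (sigma : 'S_N) :
    N.-tuple (int * M) :=
  [tuple tnth s (sigma j) | j < N].

Definition koszul N (s : N.-tuple (int * M)) (sigma : 'S_N) : K :=
  \prod_(j < N) \prod_(k < N | (j < k)%N && (sigma k < sigma j)%N)
    (-1) ^ ((tnth s (sigma j)).1 * (tnth s (sigma k)).1).

Definition shuffle N (i : nat) (sigma : 'S_N) : bool :=
  [forall j : 'I_N, forall k : 'I_N,
    (j < k)%N && ((k < i)%N || (i <= j)%N) ==> (sigma j < sigma k)%N].

Record Linfty_algebra G l : Prop := {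
  Linfty_graded : graded_space G;
  Linfty_multilinear : forall s1 s2 d (a : K) x y,
    homogeneous G s1 -> homogeneous G s2 -> G d x -> G d y ->
    l (s1 ++ (d, a *: x + y) :: s2)
      = a *: l (s1 ++ (d, x) :: s2) + l (s1 ++ (d, y) :: s2);
  Linfty_degree : forall s, (0 < size s)%N -> homogeneous G s ->
    G (degree s + 1) (l s);
  Linfty_symmetric : forall N (s : N.-tuple (int * M)) (sigma : 'S_N),
    (0 < N)%N -> homogeneous G s ->
    l (permute s sigma) = koszul s sigma *: l s;
  Linfty_jacobi : forall N (s : N.-tuple (int * M)),
    (0 < N)%N -> homogeneous G s ->
    \sum_(1 <= i < N.+1) \sum_(sigma : 'S_N | shuffle i sigma)
      koszul s sigma *:
        (let x := permute s sigma in
         l ((degree (take i x) + 1, l (take i x)) :: drop i x)) = 0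
}.

(* Here and in twist, a sum over a set is the sum of the finitely many nonzero
   terms; fsbigop returns 0 for infinitely many nonzero terms, which does not
   occur for the operations below, as a cochain with m inputs admits at most
   m + 1 successive nonzero brackets with elements of b. *)
Definition maurer_cartan G l (alpha : M) : Prop :=
  G 0 alpha /\
  \sum_(k \in [set k | (0 < k)%N])
    (k`!%:R : K)^-1 *: l (nseq k (0, alpha)) = 0.

(* Twisting by an element alpha of degree 0. *)
Definition twist l (alpha : M) : seq (int * M) -> M := fun s =>
  \sum_(n \in [set: nat]) (n`!%:R : K)^-1 *: l (nseq n (0, alpha) ++ s).

End Linfty.

(* Hom (U^{(x) n+1}, W) as a subspace of seq U -> W: a multilinear map of n+1
   variables is a function on lists of size n+1, extended by zero to lists of
   other sizes.  Thus all arities live in one space, where the subspaces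
   Hom U W n, n >= 0, are independent. *)
Definition Hom (K : fieldType) (U W : lmodType K) (n : nat) :
    set (seq U -> W) :=
  [set f | (forall s, size s != n.+1 -> f s = 0) /\
           (forall s1 s2 (a : K) u v, (size s1 + size s2)%N = n ->
              f (s1 ++ (a *: u + v) :: s2)
                = a *: f (s1 ++ u :: s2) + f (s1 ++ v :: s2))].

Arguments Hom {K} U W n.

Section Gerstenhaber.
Variables (K : fieldType) (V : lmodType K).
Implicit Types f g : seq V -> V.

(* f <> g for f and g of degrees m and n, i.e. with m+1 and n+1 inputs,
   evaluated on a list of size m+n+1. *)
Definition diamond (m n : nat) f g (s : seq V) : V :=
  \sum_(i < m.+1) (-1) ^+ (i * n) *:
    f (take i s ++ g (take n.+1 (drop i s)) :: drop (i + n.+1) s).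

(* The sum runs over the degrees m, n with m + n + 1 = size s: this is the
   bilinear extension of the bracket of homogeneous elements, a single term
   of the sum being nonzero when f and g are homogeneous. *)
Definition bracket f g : seq V -> V := fun s =>
  \sum_(n < size s)
    let m := (size s - n.+1)%N in
    (diamond m n f g s - (-1) ^+ (m * n) *: diamond n m g f s).

End Gerstenhaber.

Section QuasiTwilled.
Variables (K : fieldType) (A B : lmodType K).
Notation V := (A * B)%type.
Implicit Types (F Omega : seq V -> V) (f : seq B -> A) (n : nat).

Definition inA (a : A) : V := (a, 0).
Definition inB (x : B) : V := (0, x).
Definition inAB (c : A + B) : V :=
  match c with inl a => inA a | inr x => inB x end.

Definition g_ n : set (seq V -> V) := Hom V V n.

Definition ext f : seq V -> V := fun s => inA (f (map snd s)).

Definition b_ n : set (seq V -> V) := ext @` Hom B A n.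

Definition P F : seq V -> V := ext (fun s => (F (map inB s)).1).

(* An N-graded space seen as a Z-graded one. *)
Definition Zgraded (S : nat -> set (seq V -> V)) (d : int) : set (seq V -> V) :=
  if d is Posz n then S n else [set 0].

Definition in_tensor (k l : int) (s : seq (A + B)) : bool :=
  ((count (fun c => if c is inl _ then true else false) s)%:Z == k) &&
  ((count (fun c => if c is inr _ then true else false) s)%:Z == l).

Definition C_ (k l : int) : set (seq V -> V) :=
  [set F | Zgraded g_ (k + l) F /\
    forall s : seq (A + B),
      [/\ in_tensor (k + 1) l s -> (F (map inAB s)).2 = 0,
          in_tensor k (l + 1) s -> (F (map inAB s)).1 = 0
        & ~~ in_tensor (k + 1) l s -> ~~ in_tensor k (l + 1) s ->
          F (map inAB s) = 0]].

(* Q_n = C^{n+1|-1} + C^{n|0} + ... + C^{0|n} *)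
Definition Q_ n : set (seq V -> V) :=
  [set F | exists2 c : nat -> seq V -> V,
     forall i, (i <= n.+1)%N -> C_ (n.+1%:Z - i%:Z) (i%:Z - 1) (c i)
     & F = \sum_(i < n.+2) c i].

(* (Q[1] (+) b)_d = Q_{d+1} (+) b_d; (F, f) stands for (F[1], f). *)
Definition Qb (d : int) : set ((seq V -> V) * (seq V -> V)) :=
  [set x | Zgraded Q_ (d + 1) x.1 /\ Zgraded b_ d x.2].

(* The operations ~l_k on homogeneous entries (F_i[1], f_i) of degree d_i,
   expanded by multilinearity.  The component in Q[1] is nonzero only for
   k = 2, and |F_1| = d_1 + 1.  In the component in b, the i-th summand uses
   F_i and the f_j for j != i; moving F_i[1] to the front past f_1, ...,
   f_{i-1} costs the Koszul sign (-1)^(d_i (d_1 + ... + d_{i-1})). *)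
Definition ltilde (s : seq (int * ((seq V -> V) * (seq V -> V)))) :
    (seq V -> V) * (seq V -> V) :=
  (if s is [:: p; q] then
     ((-1) ^ (p.1 + 1) : K) *: bracket p.2.1 q.2.1
   else 0,
   if (2 <= size s)%N then
     \sum_(i < size s)
       ((-1) ^ ((s`_i).1 * degree (take i s)) : K) *:
         P (foldl (@bracket K V) (s`_i).2.1
                  [seq p.2.2 | p <- take i s ++ drop i.+1 s])
   else 0).

(* A bilinear multiplication on A (+) B is an element Omega of g_1. *)
Definition quasi_twilled Omega : Prop :=
  [/\ g_ 1 Omega,
      forall u v w, Omega [:: Omega [:: u; v]; w]
                    = Omega [:: u; Omega [:: v; w]]
    & forall x y : B, exists z : B, Omega [:: inB x; inB y] = inB z].

Definition mulA Omega (a b : A) : A := (Omega [:: inA a; inA b]).1.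
Definition theta Omega (a b : A) : B := (Omega [:: inA a; inA b]).2.
Definition lharp Omega (a : A) (y : B) : A := (Omega [:: inA a; inB y]).1.
Definition rtri Omega (a : A) (y : B) : B := (Omega [:: inA a; inB y]).2.
Definition rharp Omega (x : B) (b : A) : A := (Omega [:: inB x; inA b]).1.
Definition ltri Omega (x : B) (b : A) : B := (Omega [:: inB x; inA b]).2.
Definition mulB Omega (x y : B) : B := (Omega [:: inB x; inB y]).2.

Definition weak_deformation_map Omega (r : {linear B -> A}) : Prop :=
  forall x y : B,
    mulA Omega (r x) (r y) + lharp Omega (r x) y + rharp Omega x (r y)
    = r (mulB Omega x y + rtri Omega (r x) y + ltri Omega x (r y)
         + theta Omega (r x) (r y)).

(* r : B -> A as an element of b_0 *)
Definition elt_b (r : {linear B -> A}) : seq V -> V :=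
  ext (fun s => if s is [:: x] then r x else 0).

End QuasiTwilled.

(* Main.v *)
Require Import Defs.
From mathcomp Require Import all_boot all_order all_algebra perm.
From mathcomp Require Import boolp classical_sets functions fsbigop.
From mathcomp Require Import ring zify.

(** The operations twisted by (Omega, r) have a closed form. Elements of b
    commute with each other, so that repeated brackets with r act as ad r, and
    the sum over n of the n-fold brackets with r divided by n! is exp(ad r),
    where ad r is the right bracket X |-> [X, r].
    Hence the twisted operation in the direction of b is
      P exp(ad r) (sum_i +- [..[F_i, f_1], .., f_k] + [..[Omega, f_1], .., f_k])
    (without f_i in the i-th summand), while in the direction of Q[1] only - [Omega, F] and +- [F, G] remain
    (twistE). With P' = P exp(ad r), these are the higher derived brackets of
    Voronov for the graded Lie algebra g, its abelian subalgebra b, the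
    projection P' onto b and the element Omega.

    The operator exp(ad r) is the conjugation by the linear automorphism
    (a, x) |-> (a + r x, x) of A + B (exp_ad): it is an automorphism of the
    Gerstenhaber bracket which fixes b. Therefore the kernel of P' is a
    subalgebra, as that of P is. Moreover, a multiplication X with B a
    subalgebra satisfies P' X = 0 if and only if r is a weak deformation map
    for X (shear_conj_deformation), and [X, X] = 0 if and only if X is
    associative. In particular P' Omega = 0 and [Omega, Omega] = 0. Finally,
    Q_n is the kernel of P on g_n (Q_P), so Q is a subalgebra as well.

    The Jacobi identities for the derived brackets hold for any such data
    (derived_op_jacobi). In the direction of b, let M(s) be the expression
    between parentheses above, for a list s of arguments (total_br). The
    Leibniz rule expresses the sum over the splittings of s into (s1, s2) of
    +- [M(s1), M(s2)] through the operations in the direction of Q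
    (total_br_bracket); applying P', with
    P' [u, v] = P' [P' u, v] + P' [u, P' v] because ker P' is a subalgebra and
    b is abelian, gives the identity. In these proofs, the sums over shuffles
    are written as recursively defined signed sums over the ways to split a
    list into two (unshuffle_sum, shuffle_sumE), so that everything goes by
    induction on lists.

    The Maurer-Cartan equation for (Omega', r') is then
    [Omega, Omega'] + 1/2 [Omega', Omega'] = 0 together with
    P exp(ad r) exp(ad r') (Omega + Omega') = 0. By [Omega, Omega] = 0 the first
    says that Omega + Omega' is associative; as the two shears compose to that
    of r + r', the second says that r + r' is a weak deformation map for it.

    The graded Lie identities of the Gerstenhaber bracket come from the
    pre-Lie identity (ins_preLie) for the insertion of one cochain into
    another, itself a comparison of sums over the ways to cut a list into five
    consecutive pieces. *)

Set Implicit Arguments.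
Unset Strict Implicit.
Unset Printing Implicit Defensive.

Import GRing.Theory.

Local Open Scope classical_set_scope.
Local Open Scope ring_scope.

Local Notation Hom := Defs.Hom.

(** * Equalities in modules and signs *)

Section LmodReflection.
Variables (K : fieldType) (U : lmodType K).

(** Formal K-linear combinations, with their value in U for a list of values
    of the variables, and the coefficient of each variable. *)
Inductive lterm :=
  | LVar of nat | LZero | LAdd of lterm & lterm | LOpp of lterm
  | LScale of K & lterm.

Fixpoint leval (env : seq U) e : U :=
  match e with
  | LVar n => env`_n | LZero => 0 | LAdd e1 e2 => leval env e1 + leval env e2
  | LOpp e1 => - leval env e1 | LScale k e1 => k *: leval env e1
  end.

Fixpoint lcoef e (n : nat) : K :=
  match e with
  | LVar m => if eqn m n then 1 else 0 | LZero => 0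
  | LAdd e1 e2 => lcoef e1 n + lcoef e2 n
  | LOpp e1 => - lcoef e1 n | LScale k e1 => k * lcoef e1 n
  end.

Fixpoint lcoef_eq e1 e2 (n : nat) : Prop :=
  if n is n'.+1 then lcoef e1 n' = lcoef e2 n' /\ lcoef_eq e1 e2 n' else True.

Lemma levalE env e : leval env e = \sum_(i < size env) lcoef e i *: env`_i.
Proof.
elim: e => [n||e1 IH1 e2 IH2|e1 IH1|k e1 IH1] /=.
- have lcoefE i : (if eqn n i then 1 else 0 : K) = (n == i)%:R.
    by rewrite -[eqn n i]/(n == i); case: eqP.
  under eq_bigr do rewrite lcoefE.
  have [lt_n|le_n] := ltnP n (size env).
    rewrite (bigD1 (Ordinal lt_n)) //= eqxx scale1r big1 ?addr0 // => i.
    by rewrite -val_eqE /= eq_sym => /negPf ->; rewrite scale0r.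
  rewrite nth_default // big1 // => i _; rewrite gtn_eqF ?scale0r //.
  exact: leq_trans (ltn_ord i) le_n.
- by rewrite big1 // => i _; rewrite scale0r.
- by rewrite IH1 IH2 -big_split; apply: eq_bigr => i _; rewrite scalerDl.
- by rewrite IH1 -sumrN; apply: eq_bigr => i _; rewrite scaleNr.
- by rewrite IH1 scaler_sumr; apply: eq_bigr => i _; rewrite scalerA.
Qed.

Lemma leval_eq env e1 e2 :
  lcoef_eq e1 e2 (size env) -> leval env e1 = leval env e2.
Proof.
move=> eq_e; rewrite !levalE; apply: eq_bigr => i _; congr (_ *: _).
elim: (size env) i eq_e => [[]//|n IH] i /= [eq_n /IH{}IH].
have [lt_i|] := ltnP i n; first exact: IH (Ordinal lt_i).
by have:= ltn_ord i; rewrite ltnS => le_in le_ni;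
   rewrite (_ : i = n :> nat) //; apply/eqP; rewrite eqn_leq le_in.
Qed.

End LmodReflection.

(** The tactic lmod_coefs K reduces an equality between linear combinations in
    a K-module to the equalities of the coefficients of its atoms. *)
Ltac lmod_index x env :=
  lazymatch env with
  | ?y :: ?env' =>
    match goal with
    | _ => let _ := match goal with _ => unify x y end in constr:(0%N)
    | _ => let n := lmod_index x env' in constr:(n.+1)
    end
  end.

Ltac lmod_mem x env :=
  lazymatch env with
  | nil => constr:(false)
  | ?y :: ?env' =>
    match goal with
    | _ => let _ := match goal with _ => unify x y end in constr:(true)
    | _ => lmod_mem x env'
    end
  end.

Ltac lmod_atoms e env :=
  lazymatch e with
  | ?a + ?b => let env := lmod_atoms a env in lmod_atoms b env
  | - ?a => lmod_atoms a env
  | ?k *: ?a => lmod_atoms a env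
  | 0 => env
  | _ => lazymatch lmod_mem e env with
         | true => env
         | false => constr:(e :: env)
         end
  end.

Ltac lmod_term K e env :=
  lazymatch e with
  | ?a + ?b => let a := lmod_term K a env in let b := lmod_term K b env in
               constr:(LAdd a b)
  | - ?a => let a := lmod_term K a env in constr:(LOpp a)
  | ?k *: ?a => let a := lmod_term K a env in constr:(LScale k a)
  | 0 => constr:(LZero K)
  | _ => let n := lmod_index e env in constr:(LVar K n)
  end.

Ltac lmod_coefs K :=
  lazymatch goal with
  | |- @eq ?U ?l ?r =>
    let env := lmod_atoms l (@nil U) in
    let env := lmod_atoms r env in
    let e1 := lmod_term K l env in
    let e2 := lmod_term K r env in
    refine (@leval_eq K _ env e1 e2 _);
    cbn [lcoef_eq lcoef size eqn]; repeat split
  end.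

(** The parity of an integer, which determines the sign (-1) ^ d. *)
Definition oddz (d : int) : bool := odd (absz d).

Lemma oddzD m n : oddz (m + n) = oddz m (+) oddz n.
Proof.
have oddzE d : (-1) ^+ oddz d = (-1) ^ d :> rat.
  rewrite /oddz signr_odd; case: d => k //.
  by rewrite NegzE abszN -exprnN -exprVn invrN invr1.
have: (-1) ^+ oddz (m + n) = (-1) ^+ (oddz m (+) oddz n) :> rat.
  by rewrite oddzE expfzDr // -!oddzE signr_addb.
by case: (oddz _); case: (_ (+) _).
Qed.

Lemma oddz0 : oddz 0 = false. Proof. by []. Qed.
Lemma oddz1 : oddz 1 = true. Proof. by []. Qed.
Lemma oddzN m : oddz (- m) = oddz m.
Proof. by rewrite /oddz abszN. Qed.
Lemma oddzM m n : oddz (m * n) = oddz m && oddz n.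
Proof. by rewrite /oddz abszM oddM. Qed.

Lemma signzE (K : fieldType) (d : int) : (-1) ^ d = (-1) ^+ oddz d :> K.
Proof.
rewrite /oddz signr_odd; case: d => k //.
by rewrite NegzE abszN -exprnN -exprVn invrN invr1.
Qed.

(* Proves an equality in K between expressions in signs (-1) ^ d by cases on the
   parities of the degrees involved. *)
Ltac sign_ring :=
  rewrite ?signzE ?(oddzD, oddzM, oddzN, oddz0, oddz1) /=;
  repeat match goal with |- context [oddz ?d] => case: (oddz d) end;
  rewrite /= ?expr0 ?expr1; ring.

(** * Sums over unshuffles *)

Section SignedUnshuffles.
Variables (K : fieldType) (M U : lmodType K).
Notation T := (int * M)%type.
Implicit Types (s a b : seq T) (h : seq T -> seq T -> U) (G : int -> set M).

(** The sum of epsilon * h a b over all the ways to split s into two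
    subsequences a and b, where epsilon is the Koszul sign of the permutation
    turning s into a ++ b: an entry x put in b moves past all of a. *)
Fixpoint unshuffle_sum h s : U :=
  match s with
  | [::] => h [::] [::]
  | x :: s' => unshuffle_sum (fun a b => h (x :: a) b) s'
      + unshuffle_sum (fun a b => ((-1) ^ (x.1 * degree a) : K) *: h a (x :: b)) s'
  end.

Lemma degree_cons (x : T) s : degree (x :: s) = x.1 + degree s.
Proof. by rewrite /degree big_cons. Qed.

Lemma degree_nil : degree (M := M) [::] = 0.
Proof. by rewrite /degree big_nil. Qed.

Lemma degree_cat s1 s2 : degree (s1 ++ s2) = degree s1 + degree s2.
Proof. by rewrite /degree big_cat. Qed.

Lemma homogeneous_cons G (x : T) s :
  homogeneous G (x :: s) <-> G x.1 x.2 /\ homogeneous G s.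
Proof.
split=> [Gxs|[Gx Gs] p].
  by split=> [|p p_s]; apply: Gxs; rewrite inE ?eqxx ?p_s ?orbT.
by rewrite inE => /predU1P[->//|/Gs].
Qed.

Lemma homogeneous_nil G : homogeneous G [::].
Proof. by []. Qed.

Lemma homogeneous_cat G s1 s2 :
  homogeneous G (s1 ++ s2) <-> homogeneous G s1 /\ homogeneous G s2.
Proof.
split=> [Gs|[Gs1 Gs2] p].
  by split=> p p_s; apply: Gs; rewrite mem_cat p_s ?orbT.
by rewrite mem_cat => /orP[/Gs1|/Gs2].
Qed.

(** A splitting of s into a and b, as far as properties of the entries,
    degrees and sizes are concerned. *)
Definition splits G s a b : Prop :=
  [/\ homogeneous G a, homogeneous G b, degree s = degree a + degree b
    & size s = (size a + size b)%N].

Lemma splits_consl G (x : T) s a b :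
  G x.1 x.2 -> splits G s a b -> splits G (x :: s) (x :: a) b.
Proof.
by move=> Gx [Ga Gb ds ss]; split;
  rewrite ?homogeneous_cons // ?degree_cons ?ds ?addrA //= ss addSn.
Qed.

Lemma splits_consr G (x : T) s a b :
  G x.1 x.2 -> splits G s a b -> splits G (x :: s) a (x :: b).
Proof.
by move=> Gx [Ga Gb ds ss]; split;
  rewrite ?homogeneous_cons // ?degree_cons ?ds ?(addrCA x.1) //= ss addnS.
Qed.

Lemma eq_unshuffle_in G h h' s : homogeneous G s ->
  (forall a b, splits G s a b -> h a b = h' a b) ->
  unshuffle_sum h s = unshuffle_sum h' s.
Proof.
elim: s h h' => [|x s IH] h h' /=.
  by move=> _; apply; split; rewrite ?degree_nil ?addr0.
move=> /homogeneous_cons[Gx Gs] eq_h; congr (_ + _); apply: IH => // a b sab.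
  by apply: eq_h; apply: splits_consl.
by rewrite eq_h //; apply: splits_consr.
Qed.

Lemma eq_unshuffle h h' s : (forall a b, h a b = h' a b) ->
  unshuffle_sum h s = unshuffle_sum h' s.
Proof.
by elim: s h h' => [|x s IH] h h' eq_h //=; congr (_ + _); apply: IH => a b;
  rewrite eq_h.
Qed.

Lemma unshuffle_sumD h h' s :
  unshuffle_sum (fun a b => h a b + h' a b) s
  = unshuffle_sum h s + unshuffle_sum h' s.
Proof.
elim: s h h' => [//|x s IH] h h' /=; rewrite addrACA -[in RHS]IH.
rewrite -[in RHS]IH; congr (_ + _); apply: eq_unshuffle => a b.
by rewrite scalerDr.
Qed.

Lemma unshuffle_sumZ (c : K) h s :
  unshuffle_sum (fun a b => c *: h a b) s = c *: unshuffle_sum h s.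
Proof.
elim: s h => [//|x s IH] h /=; rewrite scalerDr -![in RHS]IH; congr (_ + _).
by apply: eq_unshuffle => a b; rewrite !scalerA mulrC.
Qed.

Lemma unshuffle_sum0 s : unshuffle_sum (fun _ _ => 0) s = 0.
Proof.
elim: s => //= x s IH; rewrite IH add0r -[RHS]IH.
by apply: eq_unshuffle => a b; rewrite scaler0.
Qed.

Lemma unshuffle_swap h s :
  unshuffle_sum h s
  = unshuffle_sum (fun a b => ((-1) ^ (degree a * degree b) : K) *: h b a) s.
Proof.
elim: s h => [|x s IH] h /=; first by rewrite degree_nil mul0r expr0z scale1r.
rewrite addrC; congr (_ + _); rewrite IH; apply: eq_unshuffle => a b;
  rewrite !scalerA degree_cons; congr (_ *: _); sign_ring.
Qed.

End SignedUnshuffles.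

Lemma unshuffle_sum_map (K : fieldType) (M U W : lmodType K)
    (G : int -> set M) (H : set U) (p : U -> W) h s :
  (forall x y, H x -> H y -> H (x + y)) ->
  (forall (c : K) x, H x -> H (c *: x)) ->
  (forall x y, H x -> H y -> p (x + y) = p x + p y) ->
  (forall (c : K) x, H x -> p (c *: x) = c *: p x) ->
  homogeneous G s -> (forall a b, splits G s a b -> H (h a b)) ->
  H (unshuffle_sum h s) /\
  p (unshuffle_sum h s) = unshuffle_sum (fun a b => p (h a b)) s.
Proof.
move=> HD HZ pD pZ; elim: s h => [|x s IH] h /=.
  by move=> _ Hh; split=> //; apply: Hh; split; rewrite ?degree_nil ?addr0.
move=> /homogeneous_cons[Gx Gs] Hh.
have [] := IH (fun a b => h (x :: a) b) Gs.
  by move=> a b sab; apply/Hh/splits_consl.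
move=> H1 E1.
have [] := IH (fun a b => (-1) ^ (x.1 * degree a) *: h a (x :: b)) Gs.
  by move=> a b sab; apply/HZ/Hh/splits_consr.
move=> H2 E2; split; first exact: HD.
rewrite pD // E1 E2; congr (_ + _); apply: eq_unshuffle_in Gs _ => a b sab.
by rewrite pZ //; apply/Hh/splits_consr.
Qed.

Lemma unshuffle_sum_nill (K : fieldType) (M U : lmodType K)
    (h : seq (int * M) -> U) s :
  unshuffle_sum (fun a b => if a is [::] then h b else 0) s = h s.
Proof.
elim: s h => //= x s IH h; rewrite unshuffle_sum0 add0r -[RHS](IH (fun b => h (x :: b))).
apply: eq_unshuffle => -[|y a] b; last by rewrite scaler0.
by rewrite degree_nil mulr0 expr0z scale1r.
Qed.

Lemma unshuffle_sum_linear (K : fieldType) (M U W : lmodType K)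
    (p : {linear U -> W}) (h : seq (int * M) -> seq (int * M) -> U) s :
  p (unshuffle_sum h s) = unshuffle_sum (fun a b => p (h a b)) s.
Proof.
have G : homogeneous (fun _ => setT) s by [].
by case: (@unshuffle_sum_map K M U W (fun _ => setT) setT p h s) => // *;
  rewrite ?linearD ?linearZ.
Qed.

(** * Koszul signs of permutations *)

Section PermutationSigns.
Variables (K : fieldType) (M : lmodType K).
Notation T := (int * M)%type.

(** The tuple t without its entry of index j. *)
Definition tuple_rem N (X : Type) (t : N.+1.-tuple X) (j : 'I_N.+1) : N.-tuple X :=
  [tuple tnth t (lift j i) | i < N].

Lemma tuple_remE N (X : Type) (t : N.+1.-tuple X) (j : 'I_N.+1) :
  tval t = take j (tuple_rem t j) ++ tnth t j :: drop j (tuple_rem t j).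
Proof.
have x0 := tnth t j; have ltj : (j <= N)%N by rewrite -ltnS.
have sz : size (take j (tuple_rem t j)) = j.
  by rewrite size_takel ?size_tuple.
have rem_nth m (ltm : (m < N)%N) : nth x0 (tuple_rem t j) m = nth x0 t (bump j m).
  by rewrite -(tnth_nth x0 (tuple_rem t j) (Ordinal ltm)) tnth_mktuple (tnth_nth x0).
apply: (@eq_from_nth _ x0).
  by rewrite size_cat sz /= size_drop !size_tuple !card_ord addnS subnKC.
rewrite size_tuple => m ltm; rewrite nth_cat sz.
case: ltngtP => [lt_mj|lt_jm|->].
- by rewrite nth_take // rem_nth ?(leq_trans lt_mj) // /bump leqNgt lt_mj.
- case: m lt_jm ltm => // m lt_jm ltm; rewrite subSn //= nth_drop subnKC //.
  by rewrite rem_nth // /bump; move: lt_jm; rewrite ltnS => ->.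
- by rewrite subnn /= (tnth_nth x0).
Qed.

(** For sigma = lift_perm j k tau, which maps j to k, the sequence s permuted
    by sigma is obtained by removing the entry k, permuting the rest by tau and
    inserting the removed entry at position j. *)
Lemma permute_lift N (s : N.+1.-tuple T) (j k : 'I_N.+1) (tau : 'S_N) :
  let p := permute (tuple_rem s k) tau in
  tval (permute s (lift_perm j k tau)) = take j p ++ tnth s k :: drop j p.
Proof.
move=> p; rewrite [LHS](tuple_remE (permute s _) j) tnth_mktuple lift_perm_id.
suff -> : tuple_rem (permute s (lift_perm j k tau)) j = p by [].
by apply: eq_from_tnth => i; rewrite !tnth_mktuple lift_perm_lift.
Qed.

(** The contribution of the pair (p, r) to the Koszul sign of sigma. *)
Definition inversion_sign N (s : N.-tuple T) (sigma : 'S_N) (p r : 'I_N) : K :=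
  if (p < r)%N && (sigma r < sigma p)%N
  then (-1) ^ ((tnth s (sigma p)).1 * (tnth s (sigma r)).1) else 1.

Lemma koszulE N (s : N.-tuple T) sigma :
  koszul s sigma = \prod_(p < N) \prod_(r < N) inversion_sign s sigma p r.
Proof. by apply: eq_bigr => p _; rewrite big_mkcond. Qed.

Lemma lift_ltn N (j : 'I_N.+1) (p r : 'I_N) : (lift j p < lift j r)%N = (p < r)%N.
Proof. by rewrite !ltnNge leq_bump2. Qed.

Lemma koszul_lift N (s : N.+1.-tuple T) (j k : 'I_N.+1) (tau : 'S_N) :
  let sigma := lift_perm j k tau in
  koszul s sigma =
    (\prod_(r < N) inversion_sign s sigma j (lift j r)
     * \prod_(p < N) inversion_sign s sigma (lift j p) j)
    * koszul (tuple_rem s k) tau.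
Proof.
move=> sigma; rewrite !koszulE (bigD1_ord j) //= (bigD1_ord j) //=.
rewrite /(inversion_sign _ _ j j) ltnn mul1r -mulrA; congr (_ * _).
rewrite -big_split; apply: eq_bigr => p _; rewrite (bigD1_ord j) //=; congr (_ * _).
apply: eq_bigr => r _.
by rewrite /inversion_sign /sigma !lift_perm_lift !lift_ltn !tnth_mktuple.
Qed.

Lemma prod_sign N (P : pred 'I_N) (c : int) (f : 'I_N -> int) :
  \prod_(i < N | P i) (-1) ^ (c * f i) = (-1) ^ (c * \sum_(i < N | P i) f i) :> K.
Proof.
elim/big_rec2: _ => [|i x y _ ->]; first by rewrite mulr0 expr0z.
by rewrite mulrDr expfzDr // oppr_eq0 oner_eq0.
Qed.

Lemma degree_take N (s : N.-tuple T) (k : nat) :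
  degree (take k s) = \sum_(j < N | (j < k)%N) (tnth s j).1.
Proof.
rewrite /degree; case: N s => [|N] s.
  by rewrite tuple0 /= big_nil big_ord0.
rewrite (big_nth (tnth s ord0)) size_take size_tuple.
have -> : (if (k < N.+1)%N then k else N.+1) = minn k N.+1 by [].
rewrite big_mkord (big_ord_widen N.+1 (fun i => (nth (tnth s ord0) (take k s) i).1)) ?geq_minr //.
apply: eq_big => [i|i]; first by rewrite leq_min ltn_ord andbT.
by rewrite leq_min => /andP[ltik _]; rewrite nth_take // -tnth_nth.
Qed.

Lemma koszul_lift0l N (s : N.+1.-tuple T) (k : 'I_N.+1) (tau : 'S_N) :
  koszul s (lift_perm ord0 k tau)
  = (-1) ^ ((tnth s k).1 * degree (take k (tuple_rem s k)))
    * koszul (tuple_rem s k) tau.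
Proof.
rewrite koszul_lift [X in _ * X * _]big1 ?mulr1; last first.
  by move=> p _; rewrite /inversion_sign ltn0.
congr (_ * _); rewrite degree_take -prod_sign.
rewrite [RHS](reindex_inj (@perm_inj _ tau)) /= [RHS]big_mkcond; apply: eq_bigr => r _.
rewrite /inversion_sign lift_perm_id lift_perm_lift lift0 /= tnth_mktuple.
suff -> : (bump k (tau r) < k)%N = (tau r < k)%N by [].
by rewrite /bump; case: (leqP k (tau r)) => [le|//]; apply/negbTE; rewrite -leqNgt leqW.
Qed.

Lemma koszul_lift0r N (s : N.+1.-tuple T) (j : 'I_N.+1) (tau : 'S_N) :
  koszul s (lift_perm j ord0 tau)
  = (-1) ^ ((tnth s ord0).1
      * degree (take j (permute (tuple_rem s ord0) tau)))
    * koszul (tuple_rem s ord0) tau.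
Proof.
rewrite koszul_lift [X in X * _ * _]big1 ?mul1r; last first.
  by move=> p _; rewrite /inversion_sign lift_perm_id ltn0 andbF.
congr (_ * _); rewrite degree_take -prod_sign.
rewrite [RHS]big_mkcond; apply: eq_bigr => r _.
rewrite /inversion_sign lift_perm_id lift_perm_lift lift0 /= !tnth_mktuple andbT mulrC.
suff -> : (bump j r < j)%N = (r < j)%N by [].
by rewrite /bump; case: (leqP j r) => [le|//]; apply/negbTE; rewrite -leqNgt leqW.
Qed.

End PermutationSigns.

(** * Shuffles and graded symmetry *)

Section Shuffles.
Variables (K : fieldType) (M U : lmodType K) (G : int -> set M).
Notation T := (int * M)%type.
Implicit Types (l : seq T -> U) (h : seq T -> seq T -> U).

(** Graded symmetry under exchange of two adjacent entries, which implies
    graded symmetry under all permutations. *)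
Definition swap_symmetric l : Prop := forall s1 x y s2,
  homogeneous G (s1 ++ x :: y :: s2) ->
  l (s1 ++ x :: y :: s2) = ((-1) ^ (x.1 * y.1) : K) *: l (s1 ++ y :: x :: s2).

Lemma move_to_front l s1 x s2 : swap_symmetric l ->
  homogeneous G (s1 ++ x :: s2) ->
  l (s1 ++ x :: s2) = ((-1) ^ (x.1 * degree s1) : K) *: l (x :: s1 ++ s2).
Proof.
move=> sym_l; elim/last_ind: s1 s2 => [|s1 y IH] s2.
  by rewrite degree_nil mulr0 expr0z scale1r.
rewrite !cat_rcons => Gs; rewrite (sym_l _ _ _ _ Gs) IH; last first.
  by move: Gs => Gs p p_s; apply: Gs; move: p_s; rewrite !mem_cat !inE (orbCA (p == x)).
rewrite scalerA -cats1 degree_cat degree_cons degree_nil; congr (_ *: _).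
by sign_ring.
Qed.

Lemma lift_perm_pair_bij N :
  bijective (fun p : 'I_N.+1 * 'S_N => lift_perm p.1 ord0 p.2).
Proof.
apply: inj_card_bij; last by rewrite card_prod !card_Sn card_ord factS.
case=> [j tau] [j' tau'] /= eq_l.
have ej : j = j'.
  by apply: (@perm_inj _ (lift_perm j ord0 tau)); rewrite [in RHS]eq_l !lift_perm_id.
rewrite -{j'}ej in eq_l *; congr (_, _); apply/permP => i.
by apply: (@lift_inj _ ord0); rewrite -!(lift_perm_lift j) eq_l.
Qed.

Lemma lift_perm0_surj N (sigma : 'S_N.+1) :
  exists k tau, sigma = lift_perm ord0 k tau.
Proof.
have [f _ fK] := lift_perm_pair_bij N.
exists (f sigma^-1%g).1, (f sigma^-1%g).2^-1%g.
by rewrite -lift_permV fK invgK.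
Qed.

(** Induction on N: sigma is lift_perm 0 k tau for some k and tau, and the
    entry k is moved to the front. *)
Lemma permute_symmetric l N (s : N.-tuple T) (sigma : 'S_N) :
  swap_symmetric l -> homogeneous G s ->
  l (permute s sigma) = koszul s sigma *: l s.
Proof.
elim: N l s sigma => [|N IH] l s sigma sym_l Gs.
  by rewrite koszulE big_ord0 scale1r [permute _ _]tuple0 [s]tuple0.
have [k [tau ->]] := lift_perm0_surj sigma.
rewrite koszul_lift0l permute_lift take0 drop0 /=.
have eq_s := tuple_remE s k; rewrite [in RHS]eq_s.
have Gs' := Gs; rewrite eq_s in Gs'.
rewrite (move_to_front sym_l Gs') cat_take_drop scalerA.
have [Gk Grem] : G (tnth s k).1 (tnth s k).2 /\ homogeneous G (tuple_rem s k).
  move: Gs' => /homogeneous_cat[G1 /homogeneous_cons[Gk G2]]; split=> //.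
  by rewrite -[tval _](cat_take_drop k); apply/homogeneous_cat.
have sym_lk : swap_symmetric (fun s' => l (tnth s k :: s')).
  move=> s1 x y s2 Gs2; apply: (sym_l (tnth s k :: s1)).
  by apply/homogeneous_cons.
rewrite (IH _ _ tau sym_lk Grem); congr (_ *: _).
by move: (koszul _ _) => c; sign_ring.
Qed.

Lemma take_drop_insert N (p : N.-tuple T) (x : T) (i : nat) : (i <= N)%N ->
  let s := take i p ++ x :: drop i p in take i s = take i p /\ drop i s = x :: drop i p.
Proof.
move=> le_iN; have sz : size (take i p) = i by rewrite size_takel ?size_tuple.
by split; rewrite ?take_cat ?drop_cat sz ltnn subnn ?take0 ?drop0 ?cats0.
Qed.

(** In an (i, N - i)-shuffle, the first entry of the sequence is sent either to
    position 0 or to position i. *)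
Lemma shuffle_liftS N i (tau : 'S_N) :
  shuffle i.+1 (lift_perm ord0 ord0 tau) = shuffle i tau.
Proof.
apply/forallP/forallP => sh j.
  apply/forallP => k; have /forallP/(_ (lift ord0 k)) := sh (lift ord0 j).
  by rewrite !lift_perm_lift !lift0 /= !ltnS.
apply/forallP => k; apply/implyP => /andP[]; have [k'|] := unliftP ord0 k; last first.
  by move=> ->; rewrite ltn0.
move=> ->; have [j'|] := unliftP ord0 j => ->.
  rewrite !lift_perm_lift !lift0 /= !ltnS => lt_jk h.
  by have /forallP/(_ k')/implyP := sh j'; rewrite lt_jk h; apply.
by rewrite lift_perm_id lift_perm_lift lift0.
Qed.

Lemma shuffle_lift N (i : 'I_N.+1) (tau : 'S_N) :
  shuffle i (lift_perm i ord0 tau) = shuffle i tau.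
Proof.
have bump_lt (k : 'I_N) : (bump i k < i)%N = (k < i)%N.
  by rewrite /bump; case: (leqP i k) => [le|//]; apply/negbTE; rewrite -leqNgt leqW.
have bump_ge (k : 'I_N) : (i <= bump i k)%N = (i <= k)%N.
  by rewrite leqNgt bump_lt -leqNgt.
apply/forallP/forallP => sh j.
  apply/forallP => k; have /forallP/(_ (lift i k)) := sh (lift i j).
  by rewrite !lift_perm_lift lift_ltn /= bump_lt bump_ge !ltnS.
apply/forallP => k; apply/implyP => /andP[].
have [k'|] := unliftP i k => ->; last first.
  have [j'|] := unliftP i j => ->; last by rewrite ltnn.
  by rewrite /= bump_lt bump_ge ltnn /= => lt_ji; rewrite leqNgt lt_ji.
have [j'|] := unliftP i j => ->; last by rewrite lift_perm_id lift_perm_lift.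
rewrite !lift_perm_lift lift_ltn /= bump_lt bump_ge !ltnS => lt_jk h.
by have /forallP/(_ k')/implyP := sh j'; rewrite lt_jk h; apply.
Qed.

Lemma shuffle_liftF N (i : nat) (j : 'I_N.+1) (tau : 'S_N) :
  (0 < j)%N -> (j : nat) != i -> shuffle i (lift_perm j ord0 tau) = false.
Proof.
move=> j_gt0 ne_ji; apply/negP => /forallP sh.
have lt_j : (j.-1 < N.+1)%N by rewrite (leq_ltn_trans (leq_pred j)).
have /forallP/(_ j)/implyP := sh (Ordinal lt_j).
rewrite /= lift_perm_id ltn0 ltn_predL j_gt0 /= => sh_j; suff: false by []; apply: sh_j.
by move: ne_ji; rewrite neq_ltn => /orP[->//|lt_ij]; rewrite -[(i <= _)%N]ltnS prednK // lt_ij orbT.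
Qed.

(** The sum over all shuffles, of any type (i, N - i), is the sum over all
    splittings of the list. *)
Lemma shuffle_sumE h N (s : N.-tuple T) :
  \sum_(i < N.+1) \sum_(sigma : 'S_N | shuffle i sigma)
    koszul s sigma *: h (take i (permute s sigma)) (drop i (permute s sigma))
  = unshuffle_sum h s.
Proof.
elim: N h s => [|N IH] h s.
  have eq1 (sigma : 'S_0) : sigma = 1%g by apply/permP => -[].
  rewrite big_ord1 (big_pred1 (1%g : 'S_0)) => [|sigma].
    by rewrite koszulE big_ord0 scale1r [s]tuple0 [permute _ _]tuple0.
  by rewrite (eq1 sigma) /= eqxx; apply/forallP => -[].
pose X (i : nat) (j : 'I_N.+1) : U := \sum_(tau : 'S_N | shuffle i (lift_perm j ord0 tau))
  koszul s (lift_perm j ord0 tau) *: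
   h (take i (permute s (lift_perm j ord0 tau))) (drop i (permute s (lift_perm j ord0 tau))).
have -> : \sum_(i < N.+2) \sum_(sigma : 'S_N.+1 | shuffle i sigma)
    koszul s sigma *: h (take i (permute s sigma)) (drop i (permute s sigma))
  = \sum_(i < N.+2) \sum_(j < N.+1) X i j.
  apply: eq_bigr => i _.
  rewrite (reindex _ (onW_bij _ (lift_perm_pair_bij N))) /=.
  by rewrite (pair_big_dep xpredT (fun j tau => shuffle i (lift_perm j ord0 tau))
    (fun j tau => _)).
have X_split (i : nat) : \sum_(j < N.+1) X i j
  = (if (0 < i)%N then X i ord0 else 0)
    + (if insub i is Some j then X i j else 0).
  rewrite (bigID (fun j : 'I_N.+1 => (j : nat) == i)) /= addrC; congr (_ + _).
    rewrite big_mkcond big_ord_recl /= big1 => [|j _].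
      by rewrite addr0 eq_sym lt0n; case: eqP.
    by case: ifP => // ne_ji; rewrite /X big_pred0 // => tau; apply: shuffle_liftF.
  case: insubP => [j _ <-|ge_iN]; first by rewrite (big_pred1 j).
  rewrite big_pred0 // => j; apply/negbTE; apply: contra ge_iN => /eqP <-.
  exact: ltn_ord.
under eq_bigr do rewrite X_split.
rewrite big_split /= big_ord_recl /= add0r [X in _ + X]big_ord_recr /=.
rewrite [insub N.+1]insubF ?ltnn // addr0.
have es : tval s = tnth s ord0 :: tuple_rem s ord0.
  by rewrite (tuple_remE s ord0) take0 drop0.
rewrite [in RHS]es.
rewrite -[unshuffle_sum h (_ :: _)]/(unshuffle_sum _ (tuple_rem s ord0)
  + unshuffle_sum _ (tuple_rem s ord0)).
rewrite -!IH; congr (_ + _); apply: eq_bigr => i _.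
  rewrite /X; apply: eq_big => [tau|tau _]; first by rewrite shuffle_liftS.
  rewrite koszul_lift0l take0 degree_nil mulr0 expr0z mul1r.
  by rewrite permute_lift take0 drop0.
rewrite insubT ?ltn_ord //= => lti; have -> : Sub (i : nat) lti = i by apply: val_inj.
rewrite /X; apply: eq_big => [tau|tau _]; first by rewrite shuffle_lift.
rewrite koszul_lift0r permute_lift.
have [-> ->] := take_drop_insert (permute (tuple_rem s ord0) tau) (tnth s ord0)
  (ltn_ord i : (i <= N)%N).
by rewrite scalerA mulrC.
Qed.

(** The same without the trivial shuffles for i = 0, if these do not
    contribute. *)
Lemma shuffle_sum1E h N (s : N.-tuple T) : (forall b, h [::] b = 0) ->
  \sum_(1 <= i < N.+1) \sum_(sigma : 'S_N | shuffle i sigma)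
    koszul s sigma *: h (take i (permute s sigma)) (drop i (permute s sigma))
  = unshuffle_sum h s.
Proof.
move=> h0; rewrite -shuffle_sumE -(big_mkord xpredT (fun i =>
  \sum_(sigma : 'S_N | shuffle i sigma)
    koszul s sigma *: h (take i (permute s sigma)) (drop i (permute s sigma)))).
rewrite [RHS]big_ltn // [X in X + _]big1 ?add0r // => sigma _.
by rewrite take0 h0 scaler0.
Qed.

End Shuffles.

(** * Higher derived brackets *)

Definition linear_subspace (K : fieldType) (L : lmodType K) (S : set L) : Prop :=
  S 0 /\ forall (a : K) x y, S x -> S y -> S (a *: x + y).

(** Linearity of the restriction of p to the subspace S. *)
Definition linear_on (K : fieldType) (L W : lmodType K) (S : set L)
    (p : L -> W) : Prop :=
  forall (a : K) x y, S x -> S y -> p (a *: x + y) = a *: p x + p y.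

Section LinearOn.
Variables (K : fieldType) (L W : lmodType K) (S : set L) (p : L -> W).
Hypothesis (subS : linear_subspace S).

Lemma subspace0 : S 0. Proof. by case: subS. Qed.
Lemma subspaceZ a x : S x -> S (a *: x).
Proof. by case: subS => S0 SD Sx; rewrite -[a *: x]addr0; apply: SD. Qed.
Lemma subspaceD x y : S x -> S y -> S (x + y).
Proof. by case: subS => S0 SD Sx /(SD 1 _ _ Sx); rewrite scale1r. Qed.
Lemma subspaceN x : S x -> S (- x).
Proof. by rewrite -scaleN1r; apply: subspaceZ. Qed.

Hypothesis linp : linear_on S p.

Lemma linear_on0 : p 0 = 0.
Proof.
have := linp 1 subspace0 subspace0; rewrite !scale1r addr0.
by move/(congr1 (+%R^~ (- p 0))); rewrite subrr addrK.
Qed.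
Lemma linear_onZ a x : S x -> p (a *: x) = a *: p x.
Proof. by move=> Sx; have := linp a Sx subspace0; rewrite linear_on0 !addr0. Qed.
Lemma linear_onD x y : S x -> S y -> p (x + y) = p x + p y.
Proof. by move=> Sx Sy; have := linp 1 Sx Sy; rewrite !scale1r. Qed.
Lemma linear_onN x : S x -> p (- x) = - p x.
Proof. by rewrite -!scaleN1r; apply: linear_onZ. Qed.

End LinearOn.

(** A graded Lie algebra with components g d in an ambient space L. The bracket
    is an operation on all of L; it is bilinear on a subspace H that contains
    all the components, and the graded identities concern homogeneous elements. *)
Record graded_Lie (K : fieldType) (L : lmodType K) (H : set L)
    (g : int -> set L) (br : L -> L -> L) : Prop := GradedLie {
  lie_sub : linear_subspace H;
  lie_homog : forall d, g d `<=` H;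
  lie_graded : forall d, linear_subspace (g d);
  lie_linl : forall y, H y -> linear_on H (br^~ y);
  lie_linr : forall x, H x -> linear_on H (br x);
  lie_closed : forall x y, H x -> H y -> H (br x y);
  lie_degree : forall m n x y, g m x -> g n y -> g (m + n) (br x y);
  lie_anti : forall m n x y, g m x -> g n y ->
    br x y = - ((-1) ^ (m * n) : K) *: br y x;
  lie_leibniz : forall m n p x y z, g m x -> g n y -> g p z ->
    br (br x y) z = br x (br y z) + ((-1) ^ (n * p) : K) *: br (br x z) y
}.

(** The setting of higher derived brackets: a graded Lie algebra g with an
    abelian subalgebra b, a projection P of g onto b whose kernel is a
    subalgebra, a subalgebra Q, and an element Om of Q_1 with [Om, Om] = 0 and
    P Om = 0. *)
Section HigherDerivedBrackets.
Variables (K : fieldType) (L : lmodType K) (H : set L) (g Q b : int -> set L).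
Variables (br : L -> L -> L) (P : L -> L) (Om : L).
Hypothesis two_neq0 : (2 : K) != 0.
Hypothesis lieL : graded_Lie H g br.
Hypothesis Q_sub : forall d, linear_subspace (Q d).
Hypothesis Q_g : forall d, Q d `<=` g d.
Hypothesis Q_br : forall m n x y, Q m x -> Q n y -> Q (m + n) (br x y).
Hypothesis b_sub : forall d, linear_subspace (b d).
Hypothesis b_g : forall d, b d `<=` g d.
Hypothesis b_br : forall m n x y, b m x -> b n y -> br x y = 0.
Hypothesis P_lin : linear_on H P.
Hypothesis P_b : forall d x, g d x -> b d (P x).
Hypothesis P_id : forall d x, b d x -> P x = x.
Hypothesis P_ker : forall m n x y, g m x -> g n y -> P x = 0 -> P y = 0 ->
  P (br x y) = 0.
Hypothesis Om_Q : Q 1 Om.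
Hypothesis OmOm : br Om Om = 0.
Hypothesis POm : P Om = 0.

Notation T := (int * (L * L))%type.
Implicit Types (s : seq T) (X Y : L).

(** The component of degree d of Q[1] + b. *)
Definition QbG (d : int) : set (L * L) :=
  [set x | Q (d + 1) x.1 /\ b d x.2].

Notation homog := (homogeneous QbG).

(** [..[[X, f_1], f_2], .., f_k] for s = (F_1, f_1), .., (F_k, f_k). *)
Definition iter_br X s : L := foldl br X [seq p.2.2 | p <- s].

(** The sum of [..[Om, f_1], .., f_k] and of the iterated brackets
    +- [..[F_i, f_1], .., f_k] (without f_i), where k is the size of s: the
    derived bracket of the entries of s before projection to b. In the
    recursion, the sign comes from moving f_1 after all other entries. *)
Fixpoint total_br s : L :=
  if s is x :: s' then
    ((-1) ^ (x.1 * degree s') : K) *: br (total_br s') x.2.2 + iter_br x.2.1 s'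
  else Om.

(** The component in Q of the derived bracket; it vanishes on more than two
    entries. *)
Definition Q_part s : L :=
  match s with
  | [:: x] => - br Om x.2.1
  | [:: x; y] => ((-1) ^ (x.1 + 1) : K) *: br x.2.1 y.2.1
  | _ => 0
  end.

(** The higher derived brackets on Q[1] + b. *)
Definition derived_op s : L * L := (Q_part s, P (total_br s)).

Let Hs := lie_sub lieL.
Let gH := lie_homog lieL.
Let gs := lie_graded lieL.
Let gbr := lie_degree lieL.

Lemma g_cast d d' x : g d x -> d = d' -> g d' x.
Proof. by move=> gx <-. Qed.
Lemma Q_H d x : Q d x -> H x. Proof. by move/Q_g/gH. Qed.
Lemma b_H d x : b d x -> H x. Proof. by move/b_g/gH. Qed.

Lemma iter_br_cons X x s : iter_br X (x :: s) = iter_br (br X x.2.2) s.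
Proof. by []. Qed.

Lemma iter_br_g d X s : g d X -> homog s -> g (d + degree s) (iter_br X s).
Proof.
elim: s d X => [|x s IH] d X gX; first by rewrite degree_nil addr0.
move=> /homogeneous_cons[[_ /b_g bx] /IH{}IH].
by rewrite degree_cons addrA; apply/IH/gbr.
Qed.

Lemma iter_br_H X s : H X -> homog s -> H (iter_br X s).
Proof.
elim: s X => [|x s IH] X HX //= /homogeneous_cons[[_ /b_H bx] /IH{}IH].
by apply/IH/(lie_closed lieL).
Qed.

Lemma iter_br_lin s : homog s -> linear_on H (iter_br^~ s).
Proof.
elim: s => [|x s IH] //= /homogeneous_cons[[_ /b_H bx] Gs] a X Y HX HY.
rewrite !iter_br_cons (lie_linl lieL) // (IH Gs) //; exact: (lie_closed lieL).
Qed.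

Lemma total_br_g s : homog s -> g (degree s + 1) (total_br s).
Proof.
elim: s => [|x s IH] /=; first by rewrite degree_nil add0r => _; apply: Q_g.
move=> /homogeneous_cons[[Qx bx] Gs]; case: (gs (degree (x :: s) + 1)) => _.
apply; first by apply: g_cast (gbr (IH Gs) (b_g bx)) _; rewrite degree_cons; ring.
by apply: g_cast (iter_br_g (Q_g Qx) Gs) _; rewrite degree_cons; ring.
Qed.

Lemma total_br_H s : homog s -> H (total_br s). Proof. by move=> /total_br_g/gH. Qed.

Lemma Q_part_Q s : homog s -> Q (degree s + 1 + 1) (Q_part s).
Proof.
have Q0 d : Q d 0 by apply: subspace0.
case: s => [|x [|y [|z s]]] //=.
  move=> /homogeneous_cons[[Qx bx] _]; rewrite degree_cons degree_nil addr0.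
  by rewrite [_ + 1]addrC; apply: subspaceN => //; apply: Q_br.
move=> /homogeneous_cons[[Qx bx] /homogeneous_cons[[Qy By] _]].
rewrite !degree_cons degree_nil addr0 (_ : _ + 1 = (x.1 + 1) + (y.1 + 1)).
  by apply: subspaceZ => //; apply: Q_br.
ring.
Qed.

Lemma derived_op_degree s : homog s -> QbG (degree s + 1) (derived_op s).
Proof. by move=> Gs; split; [apply: Q_part_Q | apply/P_b/total_br_g]. Qed.

Lemma Q_part_g s : homog s -> g (degree s + 1 + 1) (Q_part s).
Proof. by move/Q_part_Q/Q_g. Qed.

Lemma Q_part_H s : homog s -> H (Q_part s). Proof. by move/Q_part_g/gH. Qed.

(* Membership in the subspace H on which the bracket is bilinear. *)
Ltac solve_H := repeat first
  [ assumption
  | exact: (subspace0 Hs)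
  | exact: (lie_closed lieL)
  | apply: (subspaceD Hs) | apply: (subspaceZ Hs) | apply: (subspaceN Hs)
  | apply: (lie_closed lieL) | apply: iter_br_H | apply: total_br_H | apply: Q_part_H
  | match goal with
    | h : g ?d ?x |- H ?x => exact: (gH h)
    | h : Q ?d ?x |- H ?x => exact: (Q_H h)
    | h : b ?d ?x |- H ?x => exact: (b_H h)
    end ].

Lemma brDl x y z : H x -> H y -> H z -> br (x + y) z = br x z + br y z.
Proof. by move=> Hx Hy Hz; apply: (linear_onD (lie_linl lieL Hz)). Qed.
Lemma brZl c x z : H x -> H z -> br (c *: x) z = c *: br x z.
Proof. by move=> Hx Hz; apply: (linear_onZ Hs (lie_linl lieL Hz)). Qed.
Lemma brDr x y z : H x -> H y -> H z -> br z (x + y) = br z x + br z y.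
Proof. by move=> Hx Hy Hz; apply: (linear_onD (lie_linr lieL Hz)). Qed.
Lemma brZr c x z : H x -> H z -> br z (c *: x) = c *: br z x.
Proof. by move=> Hx Hz; apply: (linear_onZ Hs (lie_linr lieL Hz)). Qed.
Lemma brNl x z : H x -> H z -> br (- x) z = - br x z.
Proof. by move=> Hx Hz; apply: (linear_onN Hs (lie_linl lieL Hz)). Qed.
Lemma brNr x z : H x -> H z -> br z (- x) = - br z x.
Proof. by move=> Hx Hz; apply: (linear_onN Hs (lie_linr lieL Hz)). Qed.
Lemma br0r z : H z -> br z 0 = 0.
Proof. by move=> Hz; apply: (linear_on0 Hs (lie_linr lieL Hz)). Qed.
Lemma br0l z : H z -> br 0 z = 0.
Proof. by move=> Hz; apply: (linear_on0 Hs (lie_linl lieL Hz)). Qed.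

(** Right multiplications by elements of b commute up to sign, because b is
    abelian. *)
Lemma br_swap_b d e e' X f f' : g d X -> b e f -> b e' f' ->
  br (br X f) f' = ((-1) ^ (e * e') : K) *: br (br X f') f.
Proof.
move=> gX bf bf'; rewrite (lie_leibniz lieL gX (b_g bf) (b_g bf')).
by rewrite (b_br bf bf') br0r ?add0r; last solve_H.
Qed.

Lemma unshuffle_br h s f : homog s -> H f ->
  (forall a b', splits QbG s a b' -> H (h a b')) ->
  br (unshuffle_sum h s) f = unshuffle_sum (fun a b => br (h a b) f) s.
Proof.
move=> Gs Hf Hh.
by case: (@unshuffle_sum_map K _ _ _ QbG H (br^~ f) h s) => //;
   move=> *; rewrite ?brDl ?brZl //; solve_H.
Qed.

Lemma unshuffle_H h s : homog s ->
  (forall a b', splits QbG s a b' -> H (h a b')) -> H (unshuffle_sum h s).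
Proof.
move=> Gs Hh; have idH : linear_on H (id : L -> L) by [].
by case: (@unshuffle_sum_map K _ _ _ QbG H id h s) => //; move=> *; solve_H.
Qed.

Lemma unshuffle_P h s : homog s ->
  (forall a b', splits QbG s a b' -> H (h a b')) ->
  P (unshuffle_sum h s) = unshuffle_sum (fun a b => P (h a b)) s.
Proof.
move=> Gs Hh.
by case: (@unshuffle_sum_map K _ _ _ QbG H P h s) => //; move=> *;
   rewrite ?(linear_onD P_lin) ?(linear_onZ Hs P_lin) //; solve_H.
Qed.

Lemma iter_br_cons_last d X x s : g d X -> homog (x :: s) ->
  iter_br X (x :: s) = ((-1) ^ (x.1 * degree s) : K) *: br (iter_br X s) x.2.2.
Proof.
move=> gX /homogeneous_cons[[_ bx]].
elim: s d X gX => [|y s IH] d X gX.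
  by rewrite degree_nil mulr0 expr0z scale1r.
move=> /homogeneous_cons[[_ By] Gs].
rewrite !iter_br_cons (br_swap_b gX bx By) (linear_onZ Hs (iter_br_lin Gs)); last solve_H.
have gXy := gbr gX (b_g By).
rewrite -[iter_br _ s]/(iter_br (br X y.2.2) (x :: s)) (IH _ _ gXy Gs) scalerA.
by rewrite degree_cons; congr (_ *: _); sign_ring.
Qed.

(** Iterated right multiplication by elements of b acts on brackets by the
    shuffle form of the Leibniz rule. *)
Lemma iter_br_br m n X Y s : g m X -> g n Y -> homog s ->
  iter_br (br X Y) s = unshuffle_sum
    (fun a b => ((-1) ^ (n * degree a) : K) *: br (iter_br X a) (iter_br Y b)) s.
Proof.
elim: s m n X Y => [|x s IH] m n X Y gX gY.
  by rewrite /= degree_nil mulr0 expr0z scale1r.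
move=> /homogeneous_cons[[_ bx] Gs]; have gx := b_g bx.
rewrite iter_br_cons (lie_leibniz lieL gX gY gx).
have PL := iter_br_lin Gs.
rewrite (linear_onD PL) ?(linear_onZ Hs PL); try solve_H.
rewrite (IH _ _ _ _ gX (gbr gY gx) Gs) (IH _ _ _ _ (gbr gX gx) gY Gs).
rewrite addrC /= -unshuffle_sumZ; congr (_ + _); apply: eq_unshuffle => a b'.
  by rewrite scalerA degree_cons; congr (_ *: _); sign_ring.
by rewrite scalerA; congr (_ *: _); sign_ring.
Qed.

(** A closed form of the signed sum of the brackets of iter_br X a with
    total_br b over the splittings (a, b) of s. It satisfies the recursion of
    total_br, with [X, Om] in place of Om and [X, F] in place of F. *)
Fixpoint bracket_rec X s : L :=
  if s is x :: s' then
    ((-1) ^ (x.1 * degree s') : K) *: br (bracket_rec X s') x.2.2 + iter_br (br X x.2.1) s'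
  else br X Om.

Lemma br_total_br d X s : g d X -> homog s ->
  unshuffle_sum (fun a b => ((-1) ^ degree a : K) *: br (iter_br X a) (total_br b)) s
  = bracket_rec X s.
Proof.
move=> gX; elim: s => [|x s IH].
  by rewrite /= degree_nil expr0z scale1r.
move=> /homogeneous_cons[[Qx bx] Gs]; have gx := b_g bx; have gFx := Q_g Qx.
rewrite /= -(IH Gs) (iter_br_br gX gFx Gs) unshuffle_br //; try solve_H; last first.
  by move=> a b' [Ga Gb _ _]; solve_H.
rewrite -unshuffle_sumZ -!unshuffle_sumD.
apply: eq_unshuffle_in Gs _ => a b' [Ga Gb ds _].
have gXa := iter_br_g gX Ga; have gMb := total_br_g Gb.
have Gxa : homog (x :: a) by apply/homogeneous_cons.
rewrite ds (iter_br_cons_last gX Gxa) degree_cons.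
rewrite brDr ?brZl ?brZr; try solve_H.
rewrite (lie_leibniz lieL gXa gMb gx).
by lmod_coefs K; sign_ring.
Qed.

(** The values of Q_part on a list with first component X in Q at its head, up
    to a sign (see Q_part_cons). *)
Definition Q_part_at X s : L :=
  match s with
  | [::] => br X Om
  | [:: y] => br X y.2.1
  | _ => 0
  end.

Lemma Q_part_at_g d X s : g d X -> homog s -> g (d + degree s + 1) (Q_part_at X s).
Proof.
move=> gX; have G0 e : g e 0 by apply: subspace0.
case: s => [|y [|z s]] //=; first by rewrite degree_nil addr0 => _; apply: gbr (Q_g Om_Q).
move=> /homogeneous_cons[[/Q_g gy _] _]; rewrite degree_cons degree_nil addr0.
by rewrite -addrA; apply: gbr.
Qed.

Lemma bracket_rec_unshuffle d X s : g d X -> homog s ->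
  bracket_rec X s = unshuffle_sum (fun a b => iter_br (Q_part_at X a) b) s.
Proof.
move=> gX; elim: s => [//|x s IH] /homogeneous_cons[[Qx bx] Gs] /=.
rewrite addrC; congr (_ + _).
  rewrite -[LHS](unshuffle_sum_nill (fun s => iter_br (br X x.2.1) s)).
  apply: eq_unshuffle_in Gs _ => -[|y a] b' [Ga Gb _ _] //=.
  by rewrite (linear_on0 Hs (iter_br_lin Gb)).
rewrite IH // unshuffle_br //; try solve_H; last first.
  by move=> a b' [Ga Gb _ _]; apply: iter_br_H Gb; apply: gH (Q_part_at_g gX Ga).
rewrite -unshuffle_sumZ; apply: eq_unshuffle_in Gs _ => a b' [Ga Gb ds _].
have Gxb : homog (x :: b') by apply/homogeneous_cons.
rewrite (iter_br_cons_last (Q_part_at_g gX Ga) Gxb) scalerA ds.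
by congr (_ *: _); sign_ring.
Qed.

Lemma Q_part_cons x s : QbG x.1 x.2 ->
  Q_part (x :: s) = ((-1) ^ (x.1 + 1) : K) *: Q_part_at x.2.1 s.
Proof.
move=> [Qx _]; case: s => [|y [|z s]] /=; rewrite ?scaler0 //.
rewrite (lie_anti lieL (Q_g Om_Q) (Q_g Qx)).
by lmod_coefs K; sign_ring.
Qed.

(** The signed sum of the brackets of total_br a and total_br b over the
    splittings (a, b) is minus twice the signed sum of the iterated brackets of
    Q_part a with b: both satisfy the same recursion. *)
Lemma total_br_bracket s : homog s ->
  2%:R *: unshuffle_sum (fun a b => iter_br (Q_part a) b) s
  + unshuffle_sum (fun a b => ((-1) ^ degree a : K) *: br (total_br a) (total_br b)) s = 0.
Proof.
elim: s => [|x s IH].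
  by rewrite /= OmOm !scaler0 addr0.
move=> /homogeneous_cons[Qbx Gs]; case: (Qbx) => Qx bx.
have gx := b_g bx; have gFx := Q_g Qx.
have eq_q : unshuffle_sum (fun a b => iter_br (Q_part (x :: a)) b) s
    = ((-1) ^ (x.1 + 1) : K) *: bracket_rec x.2.1 s.
  rewrite (bracket_rec_unshuffle gFx Gs) -unshuffle_sumZ.
  apply: eq_unshuffle_in Gs _ => a b' [Ga Gb _ _].
  rewrite Q_part_cons // (linear_onZ Hs (iter_br_lin Gb)) //.
  exact: gH (Q_part_at_g gFx Ga).
have swapR : bracket_rec x.2.1 s = unshuffle_sum (fun a b => ((-1) ^ (degree a * degree b) : K)
    *: (((-1) ^ degree b : K) *: br (iter_br x.2.1 b) (total_br a))) s.
  by rewrite -(br_total_br gFx Gs) unshuffle_swap.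
have := congr1 (fun u => ((-1) ^ (x.1 * degree s) : K) *: br u x.2.2) (IH Gs).
rewrite br0l ?scaler0; last solve_H.
have HS : forall a b', splits QbG s a b' -> H (iter_br (Q_part a) b').
  by move=> a b' [Ga Gb _ _]; solve_H.
have HT : forall a b', splits QbG s a b' ->
    H (((-1) ^ degree a : K) *: br (total_br a) (total_br b')).
  by move=> a b' [Ga Gb _ _]; solve_H.
have uHS := unshuffle_H Gs HS; have uHT := unshuffle_H Gs HT.
rewrite brDl ?brZl; try solve_H.
rewrite !unshuffle_br //; try solve_H => eq0; rewrite -[RHS]eq0 /= eq_q.
have -> : unshuffle_sum (fun a b => ((-1) ^ (x.1 * degree a) : K) *:
      iter_br (Q_part a) (x :: b)) s
    = ((-1) ^ (x.1 * degree s) : K) *: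
      unshuffle_sum (fun a b => br (iter_br (Q_part a) b) x.2.2) s.
  rewrite -unshuffle_sumZ; apply: eq_unshuffle_in Gs _ => a b' [Ga Gb ds _].
  have Gxb : homog (x :: b') by apply/homogeneous_cons.
  rewrite (iter_br_cons_last (Q_part_g Ga) Gxb) scalerA ds.
  by congr (_ *: _); sign_ring.
suff -> : unshuffle_sum (fun a b => ((-1) ^ degree (x :: a) : K) *:
      br ((-1) ^ (x.1 * degree a) *: br (total_br a) x.2.2 + iter_br x.2.1 a) (total_br b)) s
    + unshuffle_sum (fun a b => ((-1) ^ (x.1 * degree a) : K) *: ((-1) ^ degree a *:
      br (total_br a) ((-1) ^ (x.1 * degree b) *: br (total_br b) x.2.2 + iter_br x.2.1 b))) s
    = ((-1) ^ (x.1 * degree s) : K) *: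
      unshuffle_sum (fun a b => br (((-1) ^ degree a : K) *: br (total_br a) (total_br b)) x.2.2) s
      + ((-1) ^ x.1 : K) *: bracket_rec x.2.1 s + ((-1) ^ x.1 : K) *: bracket_rec x.2.1 s.
  by lmod_coefs K; sign_ring.
rewrite {1}swapR -(br_total_br gFx Gs) -!unshuffle_sumZ -!unshuffle_sumD.
apply: eq_unshuffle_in Gs _ => a b' [Ga Gb ds _].
have gMa := total_br_g Ga; have gMb := total_br_g Gb.
have gPa := iter_br_g gFx Ga; have gPb := iter_br_g gFx Gb.
rewrite ds degree_cons !(brDr, brDl, brZl, brZr); try solve_H.
rewrite (lie_leibniz lieL gMa gMb gx) (lie_anti lieL gMa gPb).
by lmod_coefs K; sign_ring.
Qed.

(** Since x - P x and y - P y lie in the subalgebra ker P, and [P x, P y] = 0. *)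
Lemma P_br m n x y : g m x -> g n y ->
  P (br x y) = P (br (P x) y) + P (br x (P y)).
Proof.
move=> gx gy; have bPx := P_b gx; have bPy := P_b gy.
have P_diff d z : g d z -> g d (z - P z) /\ P (z - P z) = 0.
  move=> gz; have bz := P_b gz; split.
    by apply: subspaceD gz _ => //; apply: subspaceN => //; apply: b_g.
  rewrite (linear_onD P_lin) ?(linear_onN Hs P_lin) ?(P_id bz) ?subrr //; solve_H.
have [gx' Px'] := P_diff _ _ gx; have [gy' Py'] := P_diff _ _ gy.
have := P_ker gx' gy' Px' Py'.
rewrite !(brDl, brDr, brNl, brNr); try solve_H.
rewrite (b_br bPx bPy).
rewrite !(linear_onD P_lin, linear_onN Hs P_lin, linear_on0 Hs P_lin); try solve_H.
move=> eq0; apply/eqP; rewrite -subr_eq0 -eq0; apply/eqP.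
by lmod_coefs K; ring.
Qed.

(** The Jacobi identity in the direction of b. *)
Lemma P_jacobi s : homog s ->
  unshuffle_sum (fun a b => P (total_br ((degree a + 1, derived_op a) :: b))) s = 0.
Proof.
move=> Gs.
(* W is the part of the sum in which the inner operation is used through b; the
   brackets of total_br a and total_br b project to twice W, by P_br and the
   exchange of a and b. *)
pose W := unshuffle_sum (fun a b =>
  ((-1) ^ ((degree a + 1) * degree b) : K) *: P (br (total_br b) (P (total_br a)))) s.
have HS : forall a b', splits QbG s a b' -> H (iter_br (Q_part a) b').
  by move=> a b' [Ga Gb _ _]; solve_H.
have HT : forall a b', splits QbG s a b' ->
    H (((-1) ^ degree a : K) *: br (total_br a) (total_br b')).
  by move=> a b' [Ga Gb _ _]; solve_H.
have PS := unshuffle_P Gs HS; have PT := unshuffle_P Gs HT.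
have uHS := unshuffle_H Gs HS; have uHT := unshuffle_H Gs HT.
have := congr1 P (total_br_bracket Gs).
rewrite (linear_onD P_lin) ?(linear_onZ Hs P_lin) ?(linear_on0 Hs P_lin) //;
  try solve_H.
rewrite PS PT => eq0.
have eqW : unshuffle_sum
    (fun a b => P (((-1) ^ degree a : K) *: br (total_br a) (total_br b))) s = 2 *: W.
  have -> : 2 *: W = W + W by lmod_coefs K; ring.
  rewrite {2}/W [in X in _ + X]unshuffle_swap /W -unshuffle_sumD.
  apply: eq_unshuffle_in Gs _ => a b' [Ga Gb ds _].
  have gMa := total_br_g Ga; have gMb := total_br_g Gb; have bPM := b_g (P_b gMa).
  rewrite (linear_onZ Hs P_lin) ?(P_br gMa gMb) ?(lie_anti lieL bPM gMb);
    try solve_H.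
  rewrite (linear_onZ Hs P_lin) ?(linear_onN Hs P_lin); try solve_H.
  by lmod_coefs K; sign_ring.
have {}eq0 : 2 *: (unshuffle_sum (fun a b => P (iter_br (Q_part a) b)) s + W) = 0.
  by rewrite scalerDr -eqW.
move/eqP: eq0; rewrite scaler_eq0 (negPf two_neq0) /= => /eqP <-.
rewrite addrC /W -unshuffle_sumD; apply: eq_unshuffle_in Gs _ => a b' [Ga Gb _ _] /=.
have bPM := P_b (total_br_g Ga).
by rewrite (linear_onD P_lin) ?(linear_onZ Hs P_lin) //; solve_H.
Qed.

Lemma br_OmOm d x : g d x -> br Om (br Om x) = 0.
Proof.
move=> gx; have gOm := Q_g Om_Q; have := lie_leibniz lieL gOm gOm gx.
rewrite OmOm br0l; last solve_H.
rewrite (lie_anti lieL (gbr gOm gx) gOm).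
set u := br Om _ => eq0; have : 2 *: u = 0 by rewrite eq0; lmod_coefs K; sign_ring.
by move/eqP; rewrite scaler_eq0 (negPf two_neq0) => /eqP.
Qed.

(** The Jacobi identity in the direction of Q. It reduces to identities of the
    graded Lie algebra for one, two and three entries, and is empty beyond. *)
Lemma Q_part_jacobi s : homog s ->
  unshuffle_sum (fun a b => if a is [::] then 0 else
    Q_part ((degree a + 1, derived_op a) :: b)) s = 0.
Proof.
have gOm := Q_g Om_Q.
case: s => [//|x [|y [|z [|t s]]]] Gs.
- case/homogeneous_cons: Gs => [[/Q_g gx _] _] /=.
  rewrite scaler0 addr0 brNr ?(br_OmOm gx) ?oppr0 //; solve_H.
- move: Gs => /homogeneous_cons[[/Q_g gx _] /homogeneous_cons[[/Q_g gy _] _]].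
  rewrite /= !degree_cons !degree_nil !addr0 !scaler0 !mulr0 !expr0z !scale1r addr0.
  rewrite brZr ?brNl; try solve_H.
  by rewrite (lie_leibniz lieL gOm gx gy); lmod_coefs K; sign_ring.
- move: Gs => /homogeneous_cons[[/Q_g gx _] /homogeneous_cons[[/Q_g gy _] /homogeneous_cons[[/Q_g gz _] _]]].
  rewrite /= !degree_cons !degree_nil !addr0 !scaler0 !mulr0 !expr0z !scale1r !addr0.
  rewrite br0r ?brZl; try solve_H.
  rewrite (lie_leibniz lieL gx gy gz) (lie_anti lieL gx (gbr gy gz)).
  by lmod_coefs K; sign_ring.
rewrite -[RHS](unshuffle_sum0 _ (x :: y :: z :: t :: s)).
apply: eq_unshuffle_in Gs _ => a b' [Ga Gb _].
case: a Ga => [//|a1 [|a2 [|a3 a]]] Ga; case: b' Gb => [|b1 [|b2 b']] Gb //=.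
  by rewrite br0r ?oppr0 //; solve_H.
move: Gb => /homogeneous_cons[[/Q_g gb _] _].
by rewrite br0l ?scaler0 //; solve_H.
Qed.

Theorem derived_op_jacobi s : homog s ->
  unshuffle_sum (fun a b =>
    if a is [::] then 0 else derived_op ((degree a + 1, derived_op a) :: b)) s = 0.
Proof.
move=> Gs; set u := unshuffle_sum _ s.
suff [u1 u2] : u.1 = 0 /\ u.2 = 0 by rewrite [u]surjective_pairing u1 u2.
rewrite -[u.1]/([the {linear _ -> _} of @fst L L] u).
rewrite -[u.2]/([the {linear _ -> _} of @snd L L] u).
rewrite /u !unshuffle_sum_linear; split.
  by rewrite -(Q_part_jacobi Gs); apply: eq_unshuffle => -[|? ?].
rewrite -(P_jacobi Gs); apply: eq_unshuffle_in Gs _ => -[|? ?] b' [_ Gb _ _] //=.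
rewrite POm br0r ?(linear_on0 Hs (iter_br_lin Gb)); last solve_H.
by rewrite scaler0 addr0 (linear_on0 Hs P_lin).
Qed.

Section Multilinearity.
Variables (s1 s2 : seq T) (d : int) (a : K) (x y : L * L).
Hypotheses (G1 : homog s1) (G2 : homog s2) (Gx : QbG d x) (Gy : QbG d y).

Lemma iter_br_multilinear X : H X ->
  iter_br X (s1 ++ (d, a *: x + y) :: s2)
  = a *: iter_br X (s1 ++ (d, x) :: s2) + iter_br X (s1 ++ (d, y) :: s2).
Proof.
case: Gx Gy => [_ bx] [_ By].
elim: s1 G1 X => [|z s IH] /= => [_ X HX|/homogeneous_cons[[_ bz] Gs] X HX].
  rewrite !iter_br_cons brDr ?brZr; try solve_H.
  by rewrite (linear_onD (iter_br_lin G2)) ?(linear_onZ Hs (iter_br_lin G2)) //; solve_H.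
by rewrite !iter_br_cons IH //; solve_H.
Qed.

Lemma homogeneous_insert (z : L * L) : QbG d z -> homog (s1 ++ (d, z) :: s2).
Proof.
by move=> Gz; apply/homogeneous_cat; split=> //; apply/homogeneous_cons.
Qed.
End Multilinearity.

Lemma degree_insert (s1 s2 : seq T) d (x y : L * L) :
  degree (s1 ++ (d, x) :: s2) = degree (s1 ++ (d, y) :: s2).
Proof. by rewrite !degree_cat !degree_cons. Qed.

Lemma total_br_multilinear s1 s2 d (a : K) x y :
  homog s1 -> homog s2 -> QbG d x -> QbG d y ->
  total_br (s1 ++ (d, a *: x + y) :: s2)
  = a *: total_br (s1 ++ (d, x) :: s2) + total_br (s1 ++ (d, y) :: s2).
Proof.
move=> G1 G2 Gx Gy; elim: s1 G1 => [_|z s IH] /=.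
  case: Gx Gy => [Qx bx] [Qy By].
  rewrite brDr ?brZr; try solve_H.
  rewrite (linear_onD (iter_br_lin G2)) ?(linear_onZ Hs (iter_br_lin G2)); try solve_H.
  by lmod_coefs K; ring.
move=> /homogeneous_cons[[Qz bz] Gs].
have Hx := total_br_H (homogeneous_insert Gs G2 Gx).
have Hy := total_br_H (homogeneous_insert Gs G2 Gy).
rewrite IH // iter_br_multilinear //; try solve_H.
rewrite brDl ?brZl //; try solve_H.
rewrite (degree_insert _ _ _ _ x) (degree_insert _ _ _ y x).
by lmod_coefs K; ring.
Qed.

Lemma Q_part_multilinear s1 s2 d (a : K) x y :
  homog s1 -> homog s2 -> QbG d x -> QbG d y ->
  Q_part (s1 ++ (d, a *: x + y) :: s2)
  = a *: Q_part (s1 ++ (d, x) :: s2) + Q_part (s1 ++ (d, y) :: s2).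
Proof.
move=> G1 G2 [Qx _] [Qy _]; have gOm := Q_g Om_Q.
case: s1 G1 => [|z1 [|z2 s1]] G1; case: s2 G2 => [|t1 [|t2 s2]] G2 /=;
  rewrite ?scaler0 ?addr0 //.
- rewrite brDr ?brZr; try solve_H.
  by lmod_coefs K; ring.
- move: G2 => /homogeneous_cons[[Qt _] _]; rewrite brDl ?brZl; try solve_H.
  by lmod_coefs K; ring.
- move: G1 => /homogeneous_cons[[Qt _] _]; rewrite brDr ?brZr; try solve_H.
  by lmod_coefs K; ring.
- by case: s1 G1 => *; rewrite ?scaler0 ?addr0.
- by case: s1 G1 => *; rewrite ?scaler0 ?addr0.
- by case: s1 G1 => *; rewrite ?scaler0 ?addr0.
Qed.

Theorem derived_op_multilinear s1 s2 d (a : K) x y :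
  homog s1 -> homog s2 -> QbG d x -> QbG d y ->
  derived_op (s1 ++ (d, a *: x + y) :: s2)
  = a *: derived_op (s1 ++ (d, x) :: s2) + derived_op (s1 ++ (d, y) :: s2).
Proof.
move=> G1 G2 Gx Gy; rewrite /derived_op Q_part_multilinear // total_br_multilinear //.
have Hx := total_br_H (homogeneous_insert G1 G2 Gx).
have Hy := total_br_H (homogeneous_insert G1 G2 Gy).
by rewrite (linear_onD P_lin) ?(linear_onZ Hs P_lin) //; solve_H.
Qed.

Lemma iter_br_swap d X s1 x y s2 : g d X -> homog (s1 ++ x :: y :: s2) ->
  iter_br X (s1 ++ x :: y :: s2) = ((-1) ^ (x.1 * y.1) : K) *: iter_br X (s1 ++ y :: x :: s2).
Proof.
elim: s1 d X => [|z s1 IH] d X gX /homogeneous_cons[[_ bz]].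
  move=> /homogeneous_cons[[_ By] G2].
  by rewrite /= !iter_br_cons (br_swap_b gX bz By) (linear_onZ Hs (iter_br_lin G2)) //; solve_H.
by move=> Gs; rewrite /= !iter_br_cons; apply: IH (gbr gX (b_g bz)) Gs.
Qed.

Lemma homogeneous_swap s1 x y s2 :
  homog (s1 ++ x :: y :: s2) -> homog (s1 ++ y :: x :: s2).
Proof.
by move=> Gs p; have := Gs p; rewrite !mem_cat !inE (orbCA (p == x)).
Qed.

Lemma degree_swap s1 (x y : T) s2 :
  degree (s1 ++ x :: y :: s2) = degree (s1 ++ y :: x :: s2).
Proof. by rewrite !degree_cat !degree_cons (addrCA x.1). Qed.

Lemma total_br_swap s1 x y s2 : homog (s1 ++ x :: y :: s2) ->
  total_br (s1 ++ x :: y :: s2) = ((-1) ^ (x.1 * y.1) : K) *: total_br (s1 ++ y :: x :: s2).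
Proof.
elim: s1 => [|z s1 IH] Gs.
  case/homogeneous_cons: (Gs) => [[Qx bx] Gys].
  case/homogeneous_cons: (Gys) => [[Qy By] G2].
  have Gxs : homog (x :: s2) by apply/homogeneous_cons.
  have gM := total_br_g G2; rewrite cat0s.
  rewrite -[total_br (x :: _)]/(_ *: br (_ *: br _ _ + _) _ + _).
  rewrite -[total_br (y :: _)]/(_ *: br (_ *: br _ _ + _) _ + _).
  rewrite (iter_br_cons_last (Q_g Qx) Gys) (iter_br_cons_last (Q_g Qy) Gxs).
  rewrite !(brDl, brZl) ?(br_swap_b gM By bx); try solve_H.
  by rewrite !degree_cons; lmod_coefs K; sign_ring.
case/homogeneous_cons: (Gs) => [[Qz bz] Gs'].
have HM := total_br_H (homogeneous_swap Gs').
rewrite /= (IH Gs') (iter_br_swap (Q_g Qz) Gs') degree_swap brZl; try solve_H.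
by lmod_coefs K; ring.
Qed.

Theorem derived_op_swap s1 x y s2 : homog (s1 ++ x :: y :: s2) ->
  derived_op (s1 ++ x :: y :: s2) = ((-1) ^ (x.1 * y.1) : K) *: derived_op (s1 ++ y :: x :: s2).
Proof.
move=> Gs; have HM := total_br_H (homogeneous_swap Gs).
rewrite /derived_op (total_br_swap Gs) (linear_onZ Hs P_lin) //.
suff -> : Q_part (s1 ++ x :: y :: s2)
    = ((-1) ^ (x.1 * y.1) : K) *: Q_part (s1 ++ y :: x :: s2) by [].
case: s1 Gs {HM} => [|z1 [|z2 s1]] Gs; case: s2 Gs => [|t s2] Gs /=;
  rewrite ?scaler0 //; try by case: s1 Gs => *; rewrite scaler0.
move: Gs => /homogeneous_cons[[/Q_g gx _] /homogeneous_cons[[/Q_g gy _] _]].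
by rewrite (lie_anti lieL gx gy); lmod_coefs K; sign_ring.
Qed.

(** The higher derived brackets form an L-infinity structure on Q[1] + b. Only
    the values on nonempty lists of homogeneous elements matter. *)
Theorem derived_op_Linfty l : graded_space QbG ->
  (forall s, (0 < size s)%N -> homog s -> l s = derived_op s) -> Linfty_algebra QbG l.
Proof.
move=> G_graded eq_l; split=> //.
- move=> s1 s2 d a x y G1 G2 Gx Gy.
  have Gxy : QbG d (a *: x + y).
    case: Gx Gy => [Qx bx] [Qy By].
    by split=> /=; [case: (Q_sub (d + 1)) | case: (b_sub d)] => _; apply.
  have sz z : (0 < size (s1 ++ (d, z) :: s2))%N by rewrite size_cat addnS.
  by rewrite !eq_l ?derived_op_multilinear //; apply: homogeneous_insert.
- by move=> s sz Gs; rewrite eq_l //; apply: derived_op_degree.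
- move=> N s sigma N_gt0 Gs; apply: permute_symmetric Gs => s1 x y s2 Gs.
  have sz : (0 < size (s1 ++ x :: y :: s2))%N by rewrite size_cat addnS.
  have sz' : (0 < size (s1 ++ y :: x :: s2))%N by rewrite size_cat addnS.
  have Gs' := homogeneous_swap Gs.
  by rewrite eq_l // (derived_op_swap Gs) -eq_l.
- move=> N s N_gt0 Gs; rewrite -[RHS](derived_op_jacobi Gs).
  rewrite -(shuffle_sum1E (h := fun a b => if a is [::] then 0 else
    derived_op ((degree a + 1, derived_op a) :: b))) //.
  rewrite !big_nat; apply: eq_bigr => i /andP[i_gt0 i_leN].
  apply: eq_bigr => sigma _; congr (_ *: _) => /=.
  set p := permute s sigma.
  have Gp : homog p by move=> z /mapP[j _ ->]; apply: Gs; apply: mem_tnth.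
  have Gt : homog (take i p) by move=> z /mem_take; apply: Gp.
  have Gd : homog (drop i p) by move=> z /mem_drop; apply: Gp.
  have st : (0 < size (take i p))%N by rewrite size_takel ?size_tuple.
  have -> : l (take i p) = derived_op (take i p) by apply: eq_l.
  case: (take i p) Gt st => // x t Gt _; apply: eq_l => //.
  by apply/homogeneous_cons; split=> //; apply: derived_op_degree.
Qed.

End HigherDerivedBrackets.

(** * Sums over consecutive cuts of a list *)

Section Cuts.
Variables (K : fieldType) (X : Type) (U : lmodType K).
Implicit Types (F : seq X -> seq X -> U) (D : seq X -> seq X -> seq X -> U).

(** The sum of F a b over all the ways to write s as a ++ b. *)
Fixpoint cut F (s : seq X) : U :=
  F [::] s + (if s is v :: s' then cut (fun a b => F (v :: a) b) s' else 0).

(** The sum of D a b c over all the ways to write s as a ++ b ++ c. *)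
Definition cut3 D : seq X -> U := cut (fun a r => cut (D a) r).

Lemma eq_cut_in F F' s : (forall a b, a ++ b = s -> F a b = F' a b) ->
  cut F s = cut F' s.
Proof.
elim: s F F' => [|v s IH] F F' eqF /=; rewrite eqF //; congr (_ + _).
by apply: IH => a b eq_ab; rewrite eqF //= eq_ab.
Qed.

Lemma eq_cut F F' s : (forall a b, F a b = F' a b) -> cut F s = cut F' s.
Proof. by move=> eqF; apply: eq_cut_in. Qed.

Lemma eq_cut3_in D D' s : (forall a b c, a ++ b ++ c = s -> D a b c = D' a b c) ->
  cut3 D s = cut3 D' s.
Proof.
move=> eqD; apply: eq_cut_in => a r eq_ar; apply: eq_cut_in => b c eq_bc.
by apply: eqD; rewrite eq_bc.
Qed.

Lemma cutD F F' s : cut (fun a b => F a b + F' a b) s = cut F s + cut F' s.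
Proof.
by elim: s F F' => [|v s IH] F F' /=; rewrite ?addr0 // IH addrACA.
Qed.

Lemma cutZ (k : K) F s : cut (fun a b => k *: F a b) s = k *: cut F s.
Proof. by elim: s F => [|v s IH] F /=; rewrite ?addr0 // IH scalerDr. Qed.

Lemma cut0 s : cut (fun _ _ => 0) s = 0.
Proof. by elim: s => [|v s IH] /=; rewrite ?addr0 // IH addr0. Qed.

Lemma cut3D D D' s : cut3 (fun a b c => D a b c + D' a b c) s = cut3 D s + cut3 D' s.
Proof. by rewrite -cutD; apply: eq_cut => a r; rewrite cutD. Qed.

Lemma cut3Z (k : K) D s : cut3 (fun a b c => k *: D a b c) s = k *: cut3 D s.
Proof. by rewrite -cutZ; apply: eq_cut => a r; rewrite cutZ. Qed.

Lemma cut30 s : cut3 (fun _ _ _ => 0) s = 0.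
Proof. by rewrite -[RHS](cut0 s); apply: eq_cut => a r; rewrite cut0. Qed.

Lemma cut_assoc D s :
  cut (fun r c => cut (fun a b => D a b c) r) s = cut3 D s.
Proof.
rewrite /cut3; elim: s D => [|v s IH] D /=; rewrite ?addr0 //.
by rewrite cutD IH addrA.
Qed.

Lemma cut_exchange (F : seq X -> seq X -> seq X -> seq X -> U) s t :
  cut (fun a b => cut (fun c d => F a b c d) t) s
  = cut (fun c d => cut (fun a b => F a b c d) s) t.
Proof.
elim: s F => [|v s IH] F /=.
  by rewrite addr0; apply: eq_cut => c d; rewrite addr0.
by rewrite IH -cutD.
Qed.

(** A cut of s1 ++ w :: s2 has w either in the right or in the left piece. *)
Lemma cut_insert F (s1 : seq X) w s2 :
  cut F (s1 ++ w :: s2) = cut (fun a b => F a (b ++ w :: s2)) s1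
                          + cut (fun a b => F (s1 ++ w :: a) b) s2.
Proof.
elim: s1 F => [|v s1 IH] F /=; first by rewrite addr0.
by rewrite IH addrA.
Qed.

Lemma cut3_insert D (s1 : seq X) w s2 :
  cut3 D (s1 ++ w :: s2)
  = cut3 (fun a b c => D a b (c ++ w :: s2)) s1
    + cut (fun a b => cut (fun b' c => D a (b ++ w :: b') c) s2) s1
    + cut3 (fun a b c => D (s1 ++ w :: a) b c) s2.
Proof.
rewrite /cut3 cut_insert -cutD; congr (_ + _).
by apply: eq_cut => a b; rewrite cut_insert.
Qed.

Lemma cutE F s : cut F s = \sum_(i < (size s).+1) F (take i s) (drop i s).
Proof.
elim: s F => [|v s IH] F /=; first by rewrite big_ord_recl big_ord0.
by rewrite big_ord_recl /= IH.
Qed.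

(** If empty middle pieces do not contribute, cuts are indexed by the length
    n + 1 of the middle piece and its position i. *)
Lemma cut3E D s : (forall a c, D a [::] c = 0) ->
  cut3 D s = \sum_(n < size s) \sum_(i < (size s - n.+1).+1)
    D (take i s) (take n.+1 (drop i s)) (drop (i + n.+1) s).
Proof.
move=> D0; rewrite /cut3 cutE.
transitivity (\sum_(i < (size s).+1) \sum_(n < size s | (i + n < size s)%N)
    D (take i s) (take n.+1 (drop i s)) (drop (i + n.+1) s)).
  apply: eq_bigr => i _; rewrite cutE big_ord_recl take0 drop0 D0 add0r size_drop.
  rewrite (big_ord_widen (size s) (fun n => D (take i s) (take n.+1 (drop i s))
      (drop n.+1 (drop i s)))) ?leq_subr //.
  by apply: eq_big => [n|n _]; rewrite ?drop_drop ?ltn_subRL // addnC.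
rewrite (exchange_big_dep xpredT) //=; apply: eq_bigr => n _.
rewrite [RHS](big_ord_widen (size s).+1 (fun i => D (take i s)
   (take n.+1 (drop i s)) (drop (i + n.+1) s))).
  apply: eq_bigl => i; have := ltn_ord n; lia.
by have := ltn_ord n; lia.
Qed.

End Cuts.

Lemma cut3_map (K : fieldType) (X Y : Type) (U : lmodType K) (p : Y -> X)
    (D : seq X -> seq X -> seq X -> U) s :
  cut3 D (map p s) = cut3 (fun a b c => D (map p a) (map p b) (map p c)) s.
Proof.
have cut_map (F : seq X -> seq X -> U) t :
    cut F (map p t) = cut (fun a b => F (map p a) (map p b)) t.
  by elim: t F => [|v t IH] F //=; rewrite IH.
by rewrite /cut3 cut_map; apply: eq_cut => a r; rewrite cut_map.
Qed.

Lemma cut3_linear (K : fieldType) (X : Type) (U W : lmodType K) (p : U -> W)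
    (D : seq X -> seq X -> seq X -> U) s : linear p ->
  p (cut3 D s) = cut3 (fun a b c => p (D a b c)) s.
Proof.
move=> linp.
have pD u v : p (u + v) = p u + p v by have := linp 1 u v; rewrite !scale1r.
have p0 : p 0 = 0.
  by have /(congr1 (+%R^~ (- p 0))) := pD 0 0; rewrite addr0 subrr addrK.
have p_cut (F : seq X -> seq X -> U) t :
    p (cut F t) = cut (fun a b => p (F a b)) t.
  by elim: t F => [|v t IH] F /=; rewrite pD ?p0 ?IH.
by rewrite /cut3 p_cut; apply: eq_cut => a r; rewrite p_cut.
Qed.

(** * Multilinear maps and insertions *)

Lemma lin_funE (K : fieldType) (X : Type) (U : lmodType K) (a : K)
    (f f' : X -> U) (x : X) : (a *: f + f') x = a *: f x + f' x.
Proof. by []. Qed.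

Lemma scale_funE (K : fieldType) (X : Type) (U : lmodType K) (a : K)
    (f : X -> U) (x : X) : (a *: f) x = a *: f x.
Proof. by []. Qed.

Lemma add_funE (X : Type) (U : zmodType) (f f' : X -> U) (x : X) :
  (f + f') x = f x + f' x.
Proof. by []. Qed.

Lemma opp_funE (X : Type) (U : zmodType) (f : X -> U) (x : X) : (- f) x = - f x.
Proof. by []. Qed.

Section Multilinear.
Variables (K : fieldType) (X U : lmodType K).
Implicit Types (f : seq X -> U).

(** Multilinearity in all arities at once: the restriction of f to lists of any
    fixed size is multilinear. *)
Definition multilinear f : Prop := forall s1 s2 (a : K) u v,
  f (s1 ++ (a *: u + v) :: s2) = a *: f (s1 ++ u :: s2) + f (s1 ++ v :: s2).

Lemma multilinear0 f s1 s2 : multilinear f -> f (s1 ++ 0 :: s2) = 0.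
Proof.
move=> mf; have := mf s1 s2 1 0 0; rewrite !scale1r addr0.
by move/(congr1 (+%R^~ (- f (s1 ++ 0 :: s2)))); rewrite subrr addrK.
Qed.

Lemma multilinearZ f s1 s2 a u : multilinear f ->
  f (s1 ++ (a *: u) :: s2) = a *: f (s1 ++ u :: s2).
Proof.
by move=> mf; rewrite -[a *: u]addr0 mf multilinear0 // addr0.
Qed.

Lemma multilinearD f s1 s2 u v : multilinear f ->
  f (s1 ++ (u + v) :: s2) = f (s1 ++ u :: s2) + f (s1 ++ v :: s2).
Proof. by move=> mf; have := mf s1 s2 1 u v; rewrite !scale1r. Qed.

(** A cochain is a multilinear function that vanishes outside its arity. *)
Lemma HomP n f : Hom X U n f <->
  (forall s, size s != n.+1 -> f s = 0) /\ multilinear f.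
Proof.
split=> [[f0 mf]|[f0 mf]]; last by split=> // s1 s2 a u v _; apply: mf.
split=> // s1 s2 a u v.
have [eq_n|ne_n] := eqVneq (size s1 + size s2)%N n; first exact: mf.
by rewrite !f0 ?scaler0 ?addr0 // size_cat addnS.
Qed.

Lemma Hom_multilinear n f : Hom X U n f -> multilinear f.
Proof. by case/HomP. Qed.

Lemma Hom_size n f s : Hom X U n f -> size s != n.+1 -> f s = 0.
Proof. by case=> f0 _; apply: f0. Qed.

Lemma Hom0 n : Hom X U n 0.
Proof. by apply/HomP; split=> // s1 s2 a u v; rewrite /= scaler0 addr0. Qed.

Lemma multilinear_lin (a : K) f f' : multilinear f -> multilinear f' ->
  multilinear (a *: f + f').
Proof.
move=> mf mf' s1 s2 c u v.
rewrite !lin_funE mf mf' !scalerDr !scalerA (mulrC a).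
by rewrite addrACA.
Qed.

Lemma Hom_lin n (a : K) f f' : Hom X U n f -> Hom X U n f' ->
  Hom X U n (a *: f + f').
Proof.
move=> /HomP[f0 mf] /HomP[f0' mf']; apply/HomP; split; last exact: multilinear_lin.
by move=> s ne_s; rewrite lin_funE f0 // f0' // scaler0 addr0.
Qed.

Lemma cut3_multilinear (D : seq X -> seq X -> seq X -> U) :
  (forall b c, multilinear (fun a => D a b c)) ->
  (forall a c, multilinear (fun b => D a b c)) ->
  (forall a b, multilinear (D a b)) ->
  multilinear (cut3 D).
Proof.
move=> ma mb mc s1 s2 k u v; rewrite !cut3_insert.
have -> : cut3 (fun a b c => D a b (c ++ (k *: u + v) :: s2)) s1
    = k *: cut3 (fun a b c => D a b (c ++ u :: s2)) s1
      + cut3 (fun a b c => D a b (c ++ v :: s2)) s1.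
  by rewrite -cut3Z -cut3D; apply: eq_cut3_in => a b c _; rewrite mc.
have -> : cut3 (fun a b c => D (s1 ++ (k *: u + v) :: a) b c) s2
    = k *: cut3 (fun a b c => D (s1 ++ u :: a) b c) s2
      + cut3 (fun a b c => D (s1 ++ v :: a) b c) s2.
  by rewrite -cut3Z -cut3D; apply: eq_cut3_in => a b c _; rewrite ma.
have -> : cut (fun a b => cut (fun b' c => D a (b ++ (k *: u + v) :: b') c) s2) s1
    = k *: cut (fun a b => cut (fun b' c => D a (b ++ u :: b') c) s2) s1
      + cut (fun a b => cut (fun b' c => D a (b ++ v :: b') c) s2) s1.
  rewrite -cutZ -cutD; apply: eq_cut => a b.
  by rewrite -cutZ -cutD; apply: eq_cut => b' c; rewrite mb.
by lmod_coefs K; ring.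
Qed.

End Multilinear.

Section Insertion.
Variables (K : fieldType) (V U : lmodType K).
Implicit Types (g h : seq V -> V) (phi : seq V -> U).

Variable e : nat -> nat -> nat -> K.

(** The insertion of g into phi in all possible ways, weighted by a function
    of the numbers of arguments before, inside and after g. The operation does
    not refer to the arities of g and phi. *)
Definition ins g phi (s : seq V) : U :=
  cut3 (fun a b c => e (size a) (size b) (size c) *: phi (a ++ g b :: c)) s.

Lemma ins_linr g (k : K) phi phi' :
  ins g (k *: phi + phi') = k *: ins g phi + ins g phi'.
Proof.
apply: funext => s; rewrite lin_funE.
rewrite /ins -cut3Z -cut3D; apply: eq_cut3_in => a b c _.
rewrite lin_funE.
by lmod_coefs K; ring.
Qed.

Lemma ins_linl (k : K) g g' phi : multilinear phi ->
  ins (k *: g + g') phi = k *: ins g phi + ins g' phi.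
Proof.
move=> mphi; apply: funext => s; rewrite lin_funE.
rewrite /ins -cut3Z -cut3D; apply: eq_cut3_in => a b c _.
rewrite lin_funE mphi.
by lmod_coefs K; ring.
Qed.

Lemma ins_multilinear g phi : multilinear g -> multilinear phi ->
  multilinear (ins g phi).
Proof.
move=> mg mphi; apply: cut3_multilinear => [b c|a c|a b] s1 s2 k u v.
- by rewrite -!catA !cat_cons mphi !size_cat /=; lmod_coefs K; ring.
- by rewrite mg mphi !size_cat /=; lmod_coefs K; ring.
- by rewrite -!cat_cons !catA mphi !size_cat /=; lmod_coefs K; ring.
Qed.

Lemma ins_Hom m n g phi : Hom V V n g -> Hom V U m phi -> Hom V U (m + n) (ins g phi).
Proof.
move=> Hg Hphi; have [mg mphi] := (Hom_multilinear Hg, Hom_multilinear Hphi).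
apply/HomP; split; last exact: ins_multilinear.
move=> s ne_s; rewrite /ins -[RHS](cut30 U s); apply: eq_cut3_in => a b c eq_s.
have [eq_b|/(Hom_size Hg)->] := eqVneq (size b) n.+1; last first.
  by rewrite multilinear0 // scaler0.
rewrite (Hom_size Hphi) ?scaler0 //; move: ne_s; rewrite -eq_s !size_cat /= eq_b; lia.
Qed.

End Insertion.

(** * The Gerstenhaber bracket *)

Section Bracket.
Variables (K : fieldType) (V : lmodType K).
Implicit Types (f g : seq V -> V).

(** The weight of the composition f <> g: for g with j arguments, hence of
    degree j - 1, moved past i arguments. Degrees and successors are exchanged
    freely since j - 1 and j + 1 have the same parity. *)
Definition block_sign (i j k : nat) : K := (-1) ^+ (i * j.+1).

(** The weights of the two terms of the bracket, without reference to the
    degrees: these are read off the numbers of arguments. *)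
Definition bracket_coefl (i j k : nat) : K := (0 < j)%:R * (-1) ^+ (i * j.+1).
Definition bracket_coefr (i j k : nat) : K :=
  (0 < j)%:R * (-1) ^+ ((i + k) * j.+1) * (-1) ^+ (i * j.+1).

(** The bracket of arbitrary functions as a difference of two insertions; it
    yields bilinearity without homogeneity assumptions. *)
Lemma bracketE f g :
  bracket f g = ins bracket_coefl g f - ins bracket_coefr f g.
Proof.
apply: funext => s; rewrite add_funE opp_funE /ins.
rewrite !cut3E; try by move=> a c; rewrite /bracket_coefl /bracket_coefr /= !mul0r scale0r.
rewrite /bracket sumrB; congr (_ - _).
  apply: eq_bigr => n _; apply: eq_bigr => i _.
  have lt_in : (i + n < size s)%N by have := ltn_ord i; have := ltn_ord n; lia.
  congr (_ *: _); rewrite /bracket_coefl size_takel ?size_drop; last by lia.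
  rewrite mul1r size_takel; last by lia.
  by rewrite -[LHS]signr_odd -[RHS]signr_odd !oddM /= negbK.
(* In the second term, the number of arguments of f is used as an index instead
   of that of g. *)
rewrite (reindex_inj rev_ord_inj) /=; apply: eq_bigr => n _.
have lt_n := ltn_ord n.
rewrite (_ : (size s - (size s - n.+1).+1)%N = n); last by lia.
rewrite scaler_sumr; apply: eq_bigr => i _.
have lt_in : (i + n < size s)%N by have := ltn_ord i; lia.
rewrite scalerA; congr (_ *: _); rewrite /bracket_coefr.
rewrite size_takel ?size_drop; last by lia.
rewrite mul1r size_takel; last by lia.
rewrite (_ : (i + (size s - (i + n.+1)))%N = (size s - n.+1)%N); last by lia.
by congr (_ * _); rewrite -[LHS]signr_odd -[RHS]signr_odd !oddM /= negbK // andbC.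
Qed.

Lemma bracket_multilinear f g : multilinear f -> multilinear g ->
  multilinear (bracket f g).
Proof.
move=> mf mg; rewrite bracketE -scaleN1r addrC; apply: multilinear_lin;
  exact: ins_multilinear.
Qed.

Lemma bracket_linl (k : K) f f' g : multilinear g ->
  bracket (k *: f + f') g = k *: bracket f g + bracket f' g.
Proof.
move=> mg; rewrite !bracketE ins_linr ins_linl //.
by lmod_coefs K; ring.
Qed.

Lemma bracket_linr (k : K) f f' g : multilinear g ->
  bracket g (k *: f + f') = k *: bracket g f + bracket g f'.
Proof.
move=> mg; rewrite !bracketE ins_linr ins_linl //.
by lmod_coefs K; ring.
Qed.

Lemma eq_ins m n g f (e e' : nat -> nat -> nat -> K) :
  Hom V V n g -> Hom V V m f ->
  (forall i k, (i + k)%N = m -> e i n.+1 k = e' i n.+1 k) ->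
  ins e g f = ins e' g f.
Proof.
move=> Hg Hf eq_e; apply: funext => s; apply: eq_cut3_in => a b c _.
have [eq_b|/(Hom_size Hg)->] := eqVneq (size b) n.+1; last first.
  by rewrite (multilinear0 _ _ (Hom_multilinear Hf)) !scaler0.
have [eq_ac|ne_ac] := eqVneq (size a + size c)%N m.
  by rewrite eq_b eq_e.
by rewrite (Hom_size Hf) ?scaler0 // size_cat addnS eqSS.
Qed.

Lemma ins_scale (k : K) e g f : ins (fun i j l => k * e i j l) g f = k *: ins e g f.
Proof.
apply: funext => s; rewrite scale_funE /ins -cut3Z.
by apply: eq_cut3_in => a b c _; rewrite scalerA.
Qed.

Lemma bracket_Hom m n f g : Hom V V m f -> Hom V V n g ->
  bracket f g = ins block_sign g f - ((-1) ^+ (m * n) : K) *: ins block_sign f g.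
Proof.
move=> Hf Hg; rewrite bracketE -ins_scale; congr (_ - _).
  by apply: eq_ins Hg Hf _ => i k _; rewrite /bracket_coefl mul1r.
apply: eq_ins Hf Hg _ => i k eq_ik; rewrite /bracket_coefr mul1r eq_ik.
by congr (_ * _); rewrite -[LHS]signr_odd -[RHS]signr_odd !oddM /= negbK andbC.
Qed.

Lemma bracket_degree m n f g : Hom V V m f -> Hom V V n g ->
  Hom V V (m + n) (bracket f g).
Proof.
move=> Hf Hg; rewrite (bracket_Hom Hf Hg) -scaleNr addrC; apply: Hom_lin.
  by rewrite addnC; apply: ins_Hom.
exact: ins_Hom.
Qed.

End Bracket.

(** * The graded Lie identities *)

(* Equality of products of signs (-1) ^+ n, by parity of the exponents. *)
Ltac nat_sign :=
  rewrite -?exprD -[LHS]signr_odd -[RHS]signr_odd; congr (_ ^+ nat_of_bool _);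
  rewrite ?(oddD, oddM, oddS) /=;
  repeat match goal with |- context [odd ?n] => case: (odd n) end; done.

Section Cut5.
Variables (K : fieldType) (X : Type) (U : lmodType K).
Implicit Types (E : seq X -> seq X -> seq X -> seq X -> seq X -> U).

(** The sum of E over all the ways to cut s into five consecutive pieces. *)
Definition cut5 E : seq X -> U :=
  cut (fun a1 r => cut (fun a2 r => cut3 (E a1 a2) r) r).

Lemma cut5Z (k : K) E s :
  cut5 (fun a1 a2 a3 a4 a5 => k *: E a1 a2 a3 a4 a5) s = k *: cut5 E s.
Proof.
by rewrite -cutZ; apply: eq_cut => ? ?; rewrite -cutZ; apply: eq_cut => ? ?;
  rewrite cut3Z.
Qed.

Lemma cut5_left E s :
  cut3 (fun a b c => cut3 (fun a1 a2 a3 => E a1 a2 a3 b c) a) s = cut5 E s.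
Proof.
transitivity (cut (fun a t => cut (fun a1 q => cut (fun a2 a3 =>
    cut (fun b c => E a1 a2 a3 b c) t) q) a) s).
  apply: eq_cut => a t; rewrite cut_exchange; apply: eq_cut => a1 q.
  exact: cut_exchange.
rewrite cut_assoc; apply: eq_cut => a1 r.
exact: (cut_assoc (fun a2 a3 t => cut (E a1 a2 a3) t)).
Qed.

Lemma cut5_middle E s :
  cut3 (fun a b c => cut3 (fun b1 b2 b3 => E a b1 b2 b3 c) b) s = cut5 E s.
Proof.
apply: eq_cut => a r.
rewrite (cut_assoc (fun b1 q c => cut (fun b2 b3 => E a b1 b2 b3 c) q)).
apply: eq_cut => b1 q.
exact: (cut_assoc (fun b2 b3 c => E a b1 b2 b3 c)).
Qed.

Lemma cut5_outer E s :
  cut3 (fun a b c => cut (fun a1 a2 => cut (fun c1 c2 => E a1 a2 b c1 c2) c) a) s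
  = cut5 E s.
Proof.
transitivity (cut (fun a t => cut (fun a1 a2 => cut3 (E a1 a2) t) a) s).
  by apply: eq_cut => a t; rewrite cut_exchange.
exact: (cut_assoc (fun a1 a2 t => cut3 (E a1 a2) t)).
Qed.

End Cut5.

Section PreLie.
Variables (K : fieldType) (V U : lmodType K) (phi : seq V -> U).
Hypothesis mphi : multilinear phi.
Implicit Types (g h : seq V -> V).

Notation e := (@block_sign K).

Lemma multilinear_cut3 s1 s2 (D : seq V -> seq V -> seq V -> V) s :
  phi (s1 ++ cut3 D s :: s2) = cut3 (fun a b c => phi (s1 ++ D a b c :: s2)) s.
Proof.
have cutP (F : seq V -> seq V -> V) t :
    phi (s1 ++ cut F t :: s2) = cut (fun a b => phi (s1 ++ F a b :: s2)) t.
  elim: t F => [|v t IH] F /=; rewrite ?addr0 //.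
  by rewrite multilinearD // IH.
by rewrite /cut3 cutP; apply: eq_cut => a r; rewrite cutP.
Qed.

(** The simultaneous insertions of g and, further to the right, of h. *)
Definition ins2 g h (s : seq V) : U :=
  cut5 (fun a1 a2 a3 b c =>
    (e (size a1 + size a2 + size a3) (size b) 0 * e (size a1) (size a2) 0)
     *: phi (a1 ++ g a2 :: a3 ++ h b :: c)) s.

(** Inserting g and then h: either h goes into g, or both go into phi side by
    side in one of the two possible orders. *)
Lemma ins_ins x y g h : Hom V V x g -> Hom V V y h ->
  ins e h (ins e g phi) = ins e (ins e h g) phi + ins2 g h
                          + ((-1) ^+ (x * y) : K) *: ins2 h g.
Proof.
move=> Hg Hh; have mg := Hom_multilinear Hg; have mh := Hom_multilinear Hh.
apply: funext => s; rewrite !add_funE scale_funE.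
rewrite [ins e h _ s]/ins.
transitivity (cut3 (fun a b c => e (size a) (size b) (size c) *:
    cut3 (fun a1 a2 a3 => e (size a1) (size a2) 0 *:
      phi (a1 ++ g a2 :: a3 ++ h b :: c)) a
  + e (size a) (size b) (size c) *:
    cut (fun a1 a2 => cut (fun c1 c2 => e (size a1) (size (a2 ++ h b :: c1)) 0 *:
      phi (a1 ++ g (a2 ++ h b :: c1) :: c2)) c) a
  + e (size a) (size b) (size c) *:
    cut3 (fun c1 c2 c3 => e (size (a ++ h b :: c1)) (size c2) 0 *:
      phi ((a ++ h b :: c1) ++ g c2 :: c3)) c) s).
  by apply: eq_cut3_in => a b c _; rewrite /ins cut3_insert !scalerDr.
rewrite !cut3D.
have -> : cut3 (fun a b c => e (size a) (size b) (size c) *: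
    cut3 (fun a1 a2 a3 => e (size a1) (size a2) 0 *:
      phi (a1 ++ g a2 :: a3 ++ h b :: c)) a) s = ins2 g h s.
  rewrite /ins2 -cut5_left; apply: eq_cut3_in => a b c _.
  rewrite -cut3Z; apply: eq_cut3_in => a1 a2 a3 <-.
  by rewrite scalerA !size_cat addnA.
have -> : cut3 (fun a b c => e (size a) (size b) (size c) *:
    cut (fun a1 a2 => cut (fun c1 c2 => e (size a1) (size (a2 ++ h b :: c1)) 0 *:
      phi (a1 ++ g (a2 ++ h b :: c1) :: c2)) c) a) s = ins e (ins e h g) phi s.
  transitivity (cut5 (fun a1 a2 b c1 c2 =>
    (e (size a1 + size a2) (size b) 0 * e (size a1) (size (a2 ++ h b :: c1)) 0) *:
      phi (a1 ++ g (a2 ++ h b :: c1) :: c2)) s).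
    rewrite -cut5_outer; apply: eq_cut3_in => a b c _.
    rewrite -cutZ; apply: eq_cut_in => a1 a2 <-; rewrite -cutZ; apply: eq_cut => c1 c2.
    by rewrite scalerA !size_cat.
  rewrite -cut5_middle; apply: eq_cut3_in => a b c _.
  rewrite {1}/ins multilinear_cut3 -cut3Z; apply: eq_cut3_in => b1 b2 b3 <-.
  rewrite multilinearZ // scalerA.
  have [eq_b2|/(Hom_size Hh)->] := eqVneq (size b2) y.+1; last first.
    by rewrite (multilinear0 _ _ mg) (multilinear0 _ _ mphi) !scaler0.
  congr (_ *: _); rewrite /block_sign !size_cat /= eq_b2; nat_sign.
have -> : cut3 (fun a b c => e (size a) (size b) (size c) *:
    cut3 (fun c1 c2 c3 => e (size (a ++ h b :: c1)) (size c2) 0 *: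
      phi ((a ++ h b :: c1) ++ g c2 :: c3)) c) s
  = (-1) ^+ (x * y) *: ins2 h g s.
  rewrite /ins2 -cut5Z; apply: eq_cut => a r; apply: eq_cut => b c.
  rewrite -cut3Z; apply: eq_cut3_in => c1 c2 c3 _.
  rewrite !scalerA -catA /=.
  have [eq_b|/(Hom_size Hh)->] := eqVneq (size b) y.+1; last first.
    by rewrite (multilinear0 _ _ mphi) !scaler0.
  have [eq_c|/(Hom_size Hg)->] := eqVneq (size c2) x.+1; last first.
    by rewrite -cat_cons catA (multilinear0 _ _ mphi) !scaler0.
  congr (_ *: _); rewrite /block_sign !size_cat /= eq_b eq_c; nat_sign.
by rewrite [ins2 g h s + _]addrC.
Qed.

(** The pre-Lie identity: the associator of insertions is graded symmetric in
    g and h. *)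
Lemma ins_preLie x y g h : Hom V V x g -> Hom V V y h ->
  ins e h (ins e g phi) - ins e (ins e h g) phi
  = ((-1) ^+ (x * y) : K) *: (ins e g (ins e h phi) - ins e (ins e g h) phi).
Proof.
move=> Hg Hh; rewrite (ins_ins Hg Hh) (ins_ins Hh Hg) mulnC.
have sq : (-1) ^+ (y * x) * (-1) ^+ (y * x) = 1 :> K.
  by rewrite -exprMn mulrNN mulr1 expr1n.
lmod_coefs K; ring: sq.
Qed.

End PreLie.

Section GerstenhaberLie.
Variables (K : fieldType) (V : lmodType K).
Implicit Types (f g h : seq V -> V).

Lemma bracket_anti m n f g : Hom V V m f -> Hom V V n g ->
  bracket f g = - ((-1) ^+ (m * n) : K) *: bracket g f.
Proof.
move=> Hf Hg; rewrite (bracket_Hom Hf Hg) (bracket_Hom Hg Hf) (mulnC n m).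
have sq : (-1) ^+ (m * n) * (-1) ^+ (m * n) = 1 :> K.
  by rewrite -exprMn mulrNN mulr1 expr1n.
lmod_coefs K; ring: sq.
Qed.

Lemma bracket_leibniz m n p f g h : Hom V V m f -> Hom V V n g -> Hom V V p h ->
  bracket (bracket f g) h
  = bracket f (bracket g h) + ((-1) ^+ (n * p) : K) *: bracket (bracket f h) g.
Proof.
move=> Hf Hg Hh.
have [[mf mg] mh] := (Hom_multilinear Hf, Hom_multilinear Hg, Hom_multilinear Hh).
have subE (k : K) (v w : seq V -> V) : v - k *: w = (- k) *: w + v.
  by rewrite scaleNr addrC.
have insBr u k (v w : seq V -> V) :
    ins (@block_sign K) u (v - k *: w) = ins (@block_sign K) u v - k *: ins (@block_sign K) u w.
  by rewrite !subE ins_linr.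
have insBl u k (v w : seq V -> V) : multilinear u ->
    ins (@block_sign K) (v - k *: w) u = ins (@block_sign K) v u - k *: ins (@block_sign K) w u.
  by move=> mu; rewrite subE ins_linl // scaleNr addrC.
rewrite (bracket_Hom (bracket_degree Hf Hg) Hh) (bracket_Hom Hf (bracket_degree Hg Hh)).
rewrite (bracket_Hom (bracket_degree Hf Hh) Hg).
rewrite (bracket_Hom Hf Hg) (bracket_Hom Hf Hh) (bracket_Hom Hg Hh).
rewrite !insBr !insBl //.
have := ins_preLie mf Hg Hh; have := ins_preLie mg Hf Hh; have := ins_preLie mh Hf Hg.
move=> /eqP; rewrite subr_eq => /eqP ->.
move=> /eqP; rewrite subr_eq => /eqP ->.
move=> /eqP; rewrite subr_eq => /eqP ->.
lmod_coefs K; rewrite ?(mulnDl, mulnDr) ?exprD ?(mulnC n m) ?(mulnC p m) ?(mulnC p n).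
all: rewrite -[(-1) ^+ (m * n)]signr_odd -[(-1) ^+ (m * p)]signr_odd
  -[(-1) ^+ (n * p)]signr_odd.
all: by case: (odd (m * n)); case: (odd (m * p)); case: (odd (n * p));
  rewrite /= ?expr0 ?expr1; ring.
Qed.

End GerstenhaberLie.

(** * Cochains on a direct sum *)

Section Decomposed.
Variables (K : fieldType) (A B : lmodType K).
Notation V := (A * B)%type.
Implicit Types (F G : seq V -> V) (r : {linear B -> A}).

Notation gZ := (Zgraded (@g_ K A B)).
Notation bZ := (Zgraded (@b_ K A B)).
Notation QZ := (Zgraded (@Q_ K A B)).

Lemma multilinear_subspace : linear_subspace [set F : seq V -> V | multilinear F].
Proof.
split; first exact: Hom_multilinear (Hom0 V V 0).
by move=> a F G; apply: multilinear_lin.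
Qed.

Lemma Zgraded_multilinear d F : gZ d F -> multilinear F.
Proof.
case: d => n; first exact: Hom_multilinear.
by move=> ->; apply: Hom_multilinear (Hom0 V V 0).
Qed.

Lemma Zgraded_subspace (S : nat -> set (seq V -> V)) d :
  (forall n, linear_subspace (S n)) -> linear_subspace (Zgraded S d).
Proof.
move=> subS; case: d => n; first exact: subS.
by split=> // a F G -> ->; rewrite scaler0 addr0.
Qed.

Lemma g_subspace n : linear_subspace (@g_ K A B n).
Proof. by split; [apply: Hom0 | move=> a F G; apply: Hom_lin]. Qed.

(** The cochains on A + B form a graded Lie algebra. The bracket is bilinear on
    all multilinear functions. *)
Lemma gerstenhaber_Lie :
  graded_Lie [set F : seq V -> V | multilinear F] gZ (@bracket K V).
Proof.
have br0 F : multilinear F -> bracket (0 : seq V -> V) F = 0 /\ bracket F 0 = 0.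
  move=> mF; have := bracket_linl 1 0 0 mF; have := bracket_linr 1 0 0 mF.
  rewrite !scale1r !addr0 => /esym/eqP; rewrite -subr_eq0 addrK => /eqP ->.
  by move=> /esym/eqP; rewrite -subr_eq0 addrK => /eqP ->.
have g0 d : gZ d 0 by case: (Zgraded_subspace d g_subspace).
split.
- exact: multilinear_subspace.
- by move=> d F; apply: Zgraded_multilinear.
- by move=> d; apply: Zgraded_subspace; apply: g_subspace.
- by move=> G mG a F F' mF mF' /=; apply: bracket_linl.
- by move=> G mG a F F' mF mF' /=; apply: bracket_linr.
- by move=> F G; apply: bracket_multilinear.
- move=> m n F G gF gG; have [mF mG] := (Zgraded_multilinear gF, Zgraded_multilinear gG).
  case: m n gF gG => [m|m] [n|n] gF gG; first exact: bracket_degree gF gG.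
  + by rewrite gG (br0 F mF).2.
  + by rewrite gF (br0 G mG).1.
  + by rewrite gG (br0 F mF).2.
- move=> m n F G gF gG; have [mF mG] := (Zgraded_multilinear gF, Zgraded_multilinear gG).
  case: m n gF gG => [m|m] [n|n] gF gG; first exact: bracket_anti gF gG.
  + by rewrite gG (br0 F mF).2 (br0 F mF).1 scaler0.
  + by rewrite gF (br0 G mG).2 (br0 G mG).1 scaler0.
  + by rewrite gG (br0 F mF).2 (br0 F mF).1 scaler0.
- move=> m n p F G H gF gG gH.
  have [[mF mG] mH] := (Zgraded_multilinear gF, Zgraded_multilinear gG, Zgraded_multilinear gH).
  have mFG := bracket_multilinear mF mG; have mFH := bracket_multilinear mF mH.
  have mGH := bracket_multilinear mG mH.
  case: p gH => [p|p] gH; last first.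
    rewrite gH (br0 _ mFG).2 (br0 _ mG).2 (br0 _ mF).2 (br0 _ mG).1.
    by rewrite scaler0 addr0.
  case: n gG => [n|n] gG; last first.
    rewrite gG (br0 _ mF).2 (br0 _ mH).1 (br0 _ mF).2 (br0 _ mFH).2.
    by rewrite scaler0 addr0.
  case: m gF => [m|m] gF; last first.
    rewrite gF (br0 _ mG).1 (br0 _ mH).1 (br0 _ mGH).1 (br0 _ mG).1.
    by rewrite scaler0 addr0.
  exact: bracket_leibniz gF gG gH.
Qed.

Lemma inA_lin (a : K) (u v : A) : inA B (a *: u + v) = a *: inA B u + inA B v.
Proof. by rewrite /inA; congr (_, _); rewrite /= ?scaler0 ?addr0. Qed.

Lemma inB_lin (a : K) (u v : B) : inB A (a *: u + v) = a *: inB A u + inB A v.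
Proof. by rewrite /inB; congr (_, _); rewrite /= ?scaler0 ?addr0. Qed.

Lemma ext_Hom n (f : seq B -> A) : Hom B A n f -> Hom V V n (ext f).
Proof.
move=> /HomP[f0 mf]; apply/HomP; split=> [s ne_s|s1 s2 a u v].
  by rewrite /ext f0 ?size_map.
by rewrite /ext !map_cat /= mf inA_lin.
Qed.

Lemma b_g n : @b_ K A B n `<=` g_ n.
Proof. by move=> _ [f Hf <-]; apply: ext_Hom. Qed.

Lemma b_subspace n : linear_subspace (@b_ K A B n).
Proof.
have extE (a : K) (f f' : seq B -> A) :
    ext (a *: f + f') = a *: ext f + ext f' :> (seq V -> V).
  by apply: funext => s; rewrite lin_funE /ext lin_funE inA_lin.
split; first by exists 0; [apply: Hom0 | apply: funext => s].
move=> a _ _ [f Hf <-] [f' Hf' <-].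
by exists (a *: f + f'); [apply: Hom_lin | rewrite extE].
Qed.

(** The values of the elements of b lie in A, and these elements vanish when an
    argument is in A. *)
Lemma b_br m n F G : b_ m F -> b_ n G -> bracket F G = 0 :> (seq V -> V).
Proof.
have b_ins e k (f f' : seq B -> A) : Hom B A k f ->
    ins e (ext f') (ext f) = 0 :> (seq V -> V).
  move=> /Hom_multilinear mf; apply: funext => s.
  rewrite /ins -[RHS](cut30 _ s); apply: eq_cut3_in => a b c _.
  by rewrite /ext map_cat /= multilinear0 // scaler0.
move=> [f Hf <-] [f' Hf' <-].
by rewrite bracketE (b_ins _ _ _ _ Hf) (b_ins _ _ _ _ Hf') subr0.
Qed.

Lemma P_lin (a : K) F G : P (a *: F + G) = a *: P F + P G.
Proof. by apply: funext => s; rewrite lin_funE /P /ext lin_funE -inA_lin. Qed.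

Lemma P_b n F : g_ n F -> b_ n (P F).
Proof.
move=> /HomP[F0 mF]; exists (fun s => (F (map (@inB K A B) s)).1) => //.
apply/HomP; split=> [s ne_s|s1 s2 a u v]; first by rewrite F0 ?size_map.
by rewrite !map_cat /= inB_lin mF.
Qed.

Lemma P_id n F : b_ n F -> P F = F.
Proof.
move=> [f _ <-]; apply: funext => s; rewrite /P /ext /=; congr (inA _ (f _)).
by rewrite -!map_comp; apply: eq_map.
Qed.

(** The kernel of P consists of the cochains that map B to B. *)
Lemma P_eq0 F : P F = 0 <-> forall s : seq B, (F (map (@inB K A B) s)).1 = 0.
Proof.
split=> [PF0 s|F0]; last by apply: funext => s; rewrite /P /ext F0.
have := congr1 (fun f : seq V -> V => (f (map (@inB K A B) s)).1) PF0.
by rewrite /P /ext /= -[map snd _]map_comp map_id.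
Qed.

Lemma P_ker F G : P F = 0 -> P G = 0 -> P (bracket F G) = 0.
Proof.
have fst_lin : linear (@fst A B) by [].
have P_ins e H H' : P H = 0 -> P H' = 0 -> P (ins e H' H : seq V -> V) = 0.
  move=> /P_eq0 H0 /P_eq0 H0'; apply/P_eq0 => s.
  rewrite /ins cut3_map (cut3_linear _ _ fst_lin).
  rewrite -[RHS](cut30 _ s); apply: eq_cut3_in => a b c _ /=.
  rewrite [H' _](_ : _ = inB A (H' (map (@inB K A B) b)).2); last first.
    by rewrite [LHS]surjective_pairing H0'.
  by rewrite -map_cons -map_cat H0 scaler0.
move=> PF PG; rewrite bracketE addrC -scaleN1r P_lin !P_ins ?scaler0 ?addr0 //.
Qed.

End Decomposed.

(** * Conjugation by a shear as an exponential *)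

Section Shear.
Variables (K : fieldType) (A B : lmodType K).
Notation V := (A * B)%type.
Implicit Types (F G X : seq V -> V) (r : {linear B -> A}).

(** The automorphism exp(r) of A + B, and its inverse exp(- r). *)
Definition shear r (v : V) : V := (v.1 + r v.2, v.2).

Definition shearV r (v : V) : V := (v.1 - r v.2, v.2).

(** The conjugate of X by the shear: exp(- r) o X o (exp r, .., exp r). *)
Definition shear_conj r X : seq V -> V := fun s => shearV r (X (map (shear r) s)).

Lemma shear_lin r : linear (shear r).
Proof.
by move=> a u v; rewrite /shear; congr (_, _); rewrite /= linearP /=; lmod_coefs K; ring.
Qed.

Lemma shearV_lin r : linear (shearV r).
Proof.
by move=> a u v; rewrite /shearV; congr (_, _); rewrite /= linearP /=; lmod_coefs K; ring.
Qed.

Lemma shearV0 r : shearV r 0 = 0.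
Proof. by rewrite /shearV /= linear0 subr0. Qed.

Lemma shearVZ r (a : K) v : shearV r (a *: v) = a *: shearV r v.
Proof. by rewrite -[a *: v]addr0 shearV_lin shearV0 addr0. Qed.

Lemma shearVK r v : shear r (shearV r v) = v.
Proof. by rewrite /shear /= subrK -surjective_pairing. Qed.

Lemma shear_conj_lin r (a : K) F G : shear_conj r (a *: F + G) = a *: shear_conj r F + shear_conj r G.
Proof. by apply: funext => s; rewrite lin_funE /shear_conj lin_funE shearV_lin. Qed.

Lemma shear_conj_Hom r n F : g_ n F -> g_ n (shear_conj r F).
Proof.
move=> /HomP[F0 mF]; apply/HomP; split=> [s ne_s|s1 s2 a u v].
  by rewrite /shear_conj F0 ?size_map // shearV0.
by rewrite /shear_conj !map_cat /= shear_lin mF shearV_lin.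
Qed.

Lemma shear_conj_ins r e F G : shear_conj r (ins e F G) = ins e (shear_conj r F) (shear_conj r G).
Proof.
apply: funext => s; rewrite /shear_conj /ins cut3_map (cut3_linear _ _ (@shearV_lin r)).
apply: eq_cut3_in => a b c _; rewrite !size_map map_cat /= shearVK.
by rewrite shearVZ.
Qed.

Lemma shear_conj_bracket r F G : shear_conj r (bracket F G) = bracket (shear_conj r F) (shear_conj r G).
Proof.
by rewrite !bracketE addrC -scaleN1r shear_conj_lin !shear_conj_ins scaleN1r addrC.
Qed.

Lemma shear_conj_b r n F : b_ n F -> shear_conj r F = F.
Proof.
move=> [f _ <-]; apply: funext => s; rewrite /shear_conj /ext /shearV /inA /= linear0 subr0.
by congr (f _, _); rewrite -map_comp; apply: eq_map.
Qed.

Lemma shear_conj_comp r r' F : shear_conj r (shear_conj r' F) = shear_conj (r \+ r') F.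
Proof.
apply: funext => s; rewrite /shear_conj /shearV /= -map_comp.
rewrite (@eq_map _ _ (shear r' \o shear r) (shear (r \+ r'))); last first.
  by move=> v; rewrite /shear /= addrA.
by rewrite opprD addrA addrAC.
Qed.

End Shear.

Section Exponential.
Variables (K : fieldType) (A B : lmodType K) (r : {linear B -> A}).
Hypothesis charK0 : [pchar K] =i pred0.
Notation V := (A * B)%type.
Implicit Types (F X : seq V -> V).

Notation invfact n := ((n`!%:R : K)^-1).

Lemma invfactS n : invfact n.+1 * n.+1%:R = invfact n.
Proof.
rewrite factS natrM invfM mulrAC mulVf ?mul1r //.
by rewrite ((pcharf0P K).1 charK0).
Qed.

(** The nilpotent endomorphism (a, x) |-> (r x, 0) of A + B. *)
Definition nil_part (v : V) : V := inA B (r v.2).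

Lemma nil_part_lin : linear nil_part.
Proof. by move=> a u v; rewrite /nil_part /= linearP inA_lin. Qed.

Lemma nil_partK v : nil_part (nil_part v) = 0.
Proof. by rewrite /nil_part /= linear0. Qed.

Lemma nil_partD u v : nil_part (u + v) = nil_part u + nil_part v.
Proof. by rewrite -[u]scale1r nil_part_lin !scale1r. Qed.

Lemma nil_partZ a u : nil_part (a *: u) = a *: nil_part u.
Proof. by rewrite -[a *: u]addr0 nil_part_lin /nil_part linear0 /inA addr0. Qed.

Lemma shearE v : v + nil_part v = shear r v.
Proof. by case: v => a b; rewrite /shear; congr (_, _); rewrite /= addr0. Qed.

Lemma shearVE v : v - nil_part v = shearV r v.
Proof. by case: v => a b; rewrite /shearV; congr (_, _); rewrite /= subr0. Qed.

(** The sum of the values of X obtained by applying nil_part to one argument. *)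
Fixpoint arg_der X (s : seq V) : V :=
  if s is v :: s' then X (nil_part v :: s') + arg_der (fun t => X (v :: t)) s' else 0.

Lemma arg_derD X Y : arg_der (X + Y) = arg_der X + arg_der Y.
Proof.
apply: funext => s; rewrite add_funE; elim: s X Y => [|v s IH] X Y /=.
  by rewrite addr0.
by rewrite add_funE (IH (fun t => X (v :: t))) addrACA.
Qed.

Lemma arg_derZ (a : K) X : arg_der (a *: X) = a *: arg_der X.
Proof.
apply: funext => s; rewrite scale_funE; elim: s X => [|v s IH] X /=.
  by rewrite scaler0.
by rewrite scale_funE (IH (fun t => X (v :: t))) scalerDr.
Qed.

Lemma arg_der_nil_part X : arg_der (nil_part \o X) = nil_part \o arg_der X.
Proof.
apply: funext => s /=; elim: s X => [|v s IH] X /=; first by rewrite /nil_part linear0.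
by rewrite (IH (fun t => X (v :: t))) nil_partD.
Qed.

Lemma arg_der_cons X v : (fun t => arg_der X (v :: t))
  = (fun t => X (nil_part v :: t)) + arg_der (fun t => X (v :: t)).
Proof. by []. Qed.

Lemma multilinear_cons X v : multilinear X -> multilinear (fun t => X (v :: t)).
Proof. by move=> mX s1 s2 a u w; apply: (mX (v :: s1)). Qed.

Lemma arg_der_multilinear X : multilinear X -> multilinear (arg_der X).
Proof.
move=> mX s1 s2 a u v; elim: s1 X mX => [|w s1 IH] X mX /=.
  rewrite nil_part_lin (mX [::]).
  have -> : (fun t => X (a *: u + v :: t))
      = a *: (fun t => X (u :: t)) + (fun t => X (v :: t)).
    by apply: funext => t; rewrite lin_funE (mX [::]).
  rewrite arg_derD arg_derZ lin_funE.
  by lmod_coefs K; ring.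
rewrite (IH _ (multilinear_cons w mX)) (mX (_ :: s1)).
by lmod_coefs K; ring.
Qed.

Lemma iter_DerD n X Y : iter n arg_der (X + Y) = iter n arg_der X + iter n arg_der Y.
Proof. by elim: n => //= n ->; rewrite arg_derD. Qed.

(** As nil_part has square zero, it acts at most once on the first argument. *)
Lemma iter_Der_cons n X v s : multilinear X ->
  iter n arg_der X (v :: s) = iter n arg_der (fun t => X (v :: t)) s
    + iter n.-1 arg_der (fun t => X (nil_part v :: t)) s *+ n.
Proof.
elim: n X s => [|n IH] X s mX; first by rewrite mulr0n addr0.
rewrite iterSr (IH _ _ (arg_der_multilinear mX)) !arg_der_cons nil_partK.
have -> : (fun t => X (0 :: t)) = 0.
  by apply: funext => t; rewrite (multilinear0 [::]).
rewrite add0r iter_DerD add_funE -!iterSr -addrA addrCA; congr (_ + _).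
by case: n {IH} => [|n]; rewrite ?mulr0n ?addr0 ?mulr1n // [RHS]mulrS.
Qed.

Lemma iter_Der_eq0 n X s : multilinear X -> (size s < n)%N -> iter n arg_der X s = 0.
Proof.
elim: s n X => [|v s IH] [|n] X mX //= lt_sn.
rewrite -[LHS]/(iter n.+1 arg_der X (v :: s)) iter_Der_cons //.
have mc w := multilinear_cons w mX.
by rewrite (IH _ _ (mc v)) ?(ltnW lt_sn) // IH // mul0rn addr0.
Qed.

Lemma sum_invfact_pred (W : lmodType K) N (f : nat -> W) :
  \sum_(n < N.+1) invfact n *: (f n.-1 *+ n) = \sum_(n < N) invfact n *: f n.
Proof.
rewrite big_ord_recl mulr0n scaler0 add0r; apply: eq_bigr => n _.
by rewrite -scaler_nat scalerA /= invfactS.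
Qed.

(** The exponential of the action on the arguments is the composition with the
    shear; on lists of size k, it has only k + 1 nonzero terms. *)
Lemma exp_Der N X s : multilinear X -> (size s < N)%N ->
  \sum_(n < N) invfact n *: iter n arg_der X s = X (map (shear r) s).
Proof.
elim: s N X => [|v s IH] [//|N] X mX lt_sN.
  rewrite big_ord_recl big1 => [|n _]; first by rewrite fact0 invr1 scale1r addr0.
  by rewrite iter_Der_eq0 ?scaler0.
under eq_bigr do rewrite iter_Der_cons // scalerDr.
rewrite big_split /= (IH _ _ (multilinear_cons v mX)) ?(ltnW lt_sN) //.
rewrite (sum_invfact_pred N (fun n => iter n arg_der (fun t => X (nil_part v :: t)) s)).
rewrite (IH _ _ (multilinear_cons _ mX)) // -(multilinearD [::] _ _ _ mX) /=.
by rewrite shearE.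
Qed.

Lemma elt_b_Hom : b_ 0 (elt_b r).
Proof.
exists (fun s => if s is [:: x] then r x else 0) => //.
apply/HomP; split=> [[|x [|y s]] //|s1 s2 a u v].
case: s1 => [|x [|y s1]]; case: s2 => [|z s2] /=; rewrite ?linearP ?scaler0 ?addr0 //.
Qed.

Lemma ins_elt_b n X : g_ n X ->
  ins (@block_sign K) (elt_b r) X = arg_der X :> (seq V -> V).
Proof.
move=> HX; have mX := Hom_multilinear HX.
have Hr := b_g elt_b_Hom.
rewrite (eq_ins (e' := fun _ _ _ => 1) Hr HX); last first.
  by move=> i k _; rewrite /block_sign exprM sqrr_sign.
have b0 : elt_b r [::] = 0 by [].
have b1 v : elt_b r [:: v] = nil_part v by [].
have b2 u v t : elt_b r [:: u, v & t] = 0 by [].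
apply: funext => s; move: {HX Hr} (elt_b r) b0 b1 b2 => R R0 R1 R2.
elim: s X mX => [|v s IH] X mX.
  by rewrite /ins /cut3 /= !addr0 R0 scale1r (multilinear0 [::]).
rewrite /= -(IH _ (multilinear_cons v mX)) /ins /cut3 /=; congr (_ + _).
rewrite R0 scale1r (multilinear0 [::]) // add0r.
case: s {IH} => [|w s] /=; first by rewrite addr0 R1 scale1r.
rewrite R1 scale1r -[RHS]addr0; congr (_ + _).
rewrite -[RHS](cut0 _ s); apply: eq_cut => a b.
by rewrite R2 scale1r (multilinear0 [::]).
Qed.

Lemma elt_b_ins n X : g_ n X ->
  ins (@block_sign K) X (elt_b r) = nil_part \o X :> (seq V -> V).
Proof.
move=> HX; apply: funext => s /=.
have R0 a v c : (a, c) != ([::], [::]) -> elt_b r (a ++ v :: c) = 0 :> V.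
  by case: a => [|u [|u' a]]; case: c => [|w c].
have -> : ins (@block_sign K) X (elt_b r) s = cut (fun b c =>
    block_sign K 0 (size b) (size c) *: elt_b r (X b :: c)) s.
  case: s => [|v s] //; rewrite /ins /cut3; first by rewrite /= !addr0.
  rewrite [LHS]/= -[RHS]addr0; congr (_ + _).
  rewrite -[RHS](cut0 _ s); apply: eq_cut => a t.
  rewrite -[RHS](cut0 _ t); apply: eq_cut => b c.
  by rewrite -[X in elt_b r X]/((v :: a) ++ X b :: c) R0 ?scaler0.
rewrite cutE big_ord_recr /= take_size drop_size big1 => [|i _].
  by rewrite add0r /block_sign scale1r.
rewrite -[X in elt_b r X]/([::] ++ _ :: drop i s) R0 ?scaler0 //.
by rewrite xpair_eqE /= -size_eq0 size_drop subn_eq0 -ltnNge.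
Qed.

(** The right bracket with r: X |-> [X, r]. *)
Definition ad X := bracket X (elt_b r).

Lemma ad_Hom n k X : g_ n X -> g_ n (iter k ad X).
Proof.
move=> HX; elim: k => //= k IH; rewrite -[n]addn0.
exact: bracket_degree IH (b_g elt_b_Hom).
Qed.

Lemma iter_ad n k X s : g_ n X ->
  iter k ad X s = iter k arg_der X s - nil_part (iter k.-1 arg_der X s *+ k).
Proof.
have adE Y : g_ n Y -> ad Y = arg_der Y - (nil_part \o Y).
  move=> HY; rewrite /ad (bracket_Hom HY (b_g elt_b_Hom)) muln0 scale1r.
  by rewrite (ins_elt_b HY) (elt_b_ins HY).
move=> HX; elim: k s => [|k IH] s.
  by rewrite mulr0n /nil_part linear0 /inA subr0.
rewrite iterS adE; last exact: ad_Hom.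
have -> : iter k ad X = iter k arg_der X - (k%:R : K) *: (nil_part \o iter k.-1 arg_der X).
  apply: funext => t; rewrite IH add_funE opp_funE scale_funE /=.
  by rewrite -scaler_nat nil_partZ.
rewrite -scaleN1r -scaleN1r scalerA addrC arg_derD arg_derZ arg_der_nil_part.
rewrite !add_funE !scale_funE /= !add_funE !scale_funE /= nil_partD nil_partZ nil_partK scaler0 addr0.
have -> : nil_part (iter k arg_der X s *+ k.+1) = k.+1%:R *: nil_part (iter k arg_der X s).
  by rewrite -scaler_nat nil_partZ.
case: k {IH} => [|k] /=; first by rewrite mulr0 scale0r; lmod_coefs K; ring.
by rewrite [in RHS]mulrSr; lmod_coefs K; ring.
Qed.

Lemma iter_ad_eq0 n k X : g_ n X -> (n.+2 < k)%N -> iter k ad X = 0.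
Proof.
move=> HX lt_nk; apply: funext => s; have mX := Hom_multilinear HX.
have [eq_s|/(Hom_size (ad_Hom k HX))//] := eqVneq (size s) n.+1.
rewrite (iter_ad _ _ HX) !iter_Der_eq0 ?eq_s //; last 2 first.
- by rewrite -ltnS prednK //; apply: leq_ltn_trans lt_nk.
- exact: ltn_trans lt_nk.
by rewrite mul0rn /nil_part linear0 subr0.
Qed.

(** The conjugation by the shear is the exponential of ad. *)
Lemma exp_ad n N X : g_ n X -> (n.+2 < N)%N ->
  \sum_(k < N) invfact k *: iter k ad X = shear_conj r X.
Proof.
case: N => // N HX lt_nN; apply: funext => s; have mX := Hom_multilinear HX.
rewrite fct_sumE /=; under eq_bigr do rewrite scale_funE.
have [eq_s|ne_s] := eqVneq (size s) n.+1; last first.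
  rewrite (Hom_size (shear_conj_Hom r HX)) // big1 // => k _.
  by rewrite (Hom_size (ad_Hom k HX)) ?scaler0.
under eq_bigr do rewrite (iter_ad _ _ HX) scalerBr -nil_partZ.
rewrite sumrB (exp_Der mX) ?eq_s; last exact: ltn_trans lt_nN.
have sum_nil (f : nat -> V) m : \sum_(k < m) nil_part (f k) = nil_part (\sum_(k < m) f k).
  elim: m => [|m IHm]; first by rewrite !big_ord0 /nil_part linear0.
  by rewrite !big_ord_recr /= IHm nil_partD.
rewrite (sum_nil (fun k => invfact k *: (iter k.-1 arg_der X s *+ k))).
rewrite (sum_invfact_pred N (fun k => iter k arg_der X s)) (exp_Der mX) ?eq_s //.
exact: shearVE.
Qed.

End Exponential.

(** * Cochains by bidegree *)

Section Bidegree.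
Variables (K : fieldType) (A B : lmodType K).
Notation V := (A * B)%type.
Implicit Types (F G X : seq V -> V).

Definition is_inl (c : A + B) : bool := if c is inl _ then true else false.
Definition is_inr (c : A + B) : bool := if c is inr _ then true else false.

(** The part of F with exactly p arguments in A: the sum over the choices of p
    arguments of the values of F at the A-components of these arguments and the
    B-components of the others. *)
Fixpoint bideg_part (p : nat) F (s : seq V) : V :=
  if s is v :: s' then
    (if p is p'.+1 then bideg_part p' (fun t => F (inA B v.1 :: t)) s' else 0)
    + bideg_part p (fun t => F (inB A v.2 :: t)) s'
  else if p is 0%N then F [::] else 0.

Lemma bideg_part_lin p (a : K) F G s :
  bideg_part p (a *: F + G) s = a *: bideg_part p F s + bideg_part p G s.
Proof.
elim: s p F G => [|v s IH] [|p] F G /=; rewrite ?scaler0 ?addr0 //.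
  by rewrite !add0r (IH 0%N (fun t => F (inB A v.2 :: t)) (fun t => G (inB A v.2 :: t))).
rewrite (IH p (fun t => F (inA B v.1 :: t)) (fun t => G (inA B v.1 :: t))).
rewrite (IH p.+1 (fun t => F (inB A v.2 :: t)) (fun t => G (inB A v.2 :: t))).
by rewrite scalerDr addrACA.
Qed.

Lemma bideg_part_multilinear p F : multilinear F -> multilinear (bideg_part p F).
Proof.
move=> mF s1 s2 a u v; elim: s1 p F mF => [|w s1 IH] p F mF /=; last first.
  have IHc q x := IH q _ (multilinear_cons x mF).
  rewrite !IHc; case: p => [|p]; first by rewrite !add0r.
  by rewrite IHc scalerDr addrACA.
have linA : (fun t => F (inA B (a *: u.1 + v.1) :: t))
    = a *: (fun t => F (inA B u.1 :: t)) + (fun t => F (inA B v.1 :: t)).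
  by apply: funext => t; rewrite inA_lin (mF [::]).
have linB : (fun t => F (inB A (a *: u.2 + v.2) :: t))
    = a *: (fun t => F (inB A u.2 :: t)) + (fun t => F (inB A v.2 :: t)).
  by apply: funext => t; rewrite inB_lin (mF [::]).
rewrite linB bideg_part_lin; case: p => [|p]; first by rewrite !add0r.
by rewrite linA bideg_part_lin scalerDr addrACA.
Qed.

Lemma bideg_part_eq0 p F s : (forall t, size t = size s -> F t = 0) -> bideg_part p F s = 0.
Proof.
elim: s p F => [|v s IH] [|p] F F0 //=; first exact: F0.
  by rewrite IH ?addr0 // => t eq_t; rewrite F0 //= eq_t.
by rewrite !IH ?addr0 // => t eq_t; rewrite F0 //= eq_t.
Qed.

Lemma bideg_part_pure p F (t : seq (A + B)) : multilinear F ->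
  bideg_part p F (map (@inAB K A B) t)
  = if count is_inl t == p then F (map (@inAB K A B) t) else 0.
Proof.
elim: t p F => [|c t IH] p F mF /=; first by case: p.
have bideg_part0 q (v : V) : v = 0 -> bideg_part q (fun u => F (v :: u)) (map (@inAB K A B) t) = 0.
  by move=> ->; apply: bideg_part_eq0 => u _; rewrite (multilinear0 [::]).
case: c => [x|x] /=.
  rewrite [X in _ + X]bideg_part0 // addr0; case: p => [//|p].
  by rewrite (IH _ _ (multilinear_cons _ mF)).
rewrite add0n (IH _ _ (multilinear_cons _ mF)).
by case: p => [|p]; rewrite ?bideg_part0 // add0r.
Qed.

Lemma bideg_part_sum F s N : multilinear F -> (size s <= N)%N ->
  \sum_(p < N.+1) bideg_part p F s = F s.
Proof.
elim: s N F => [|v s IH] N F mF /=.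
  by move=> _; rewrite big_ord_recl big1 ?addr0.
case: N => // N lt_sN; rewrite big_split /=.
rewrite (IH N.+1 _ (multilinear_cons _ mF)) 1?ltnW //.
rewrite big_ord_recl /= add0r (IH N _ (multilinear_cons _ mF)) //.
rewrite -(multilinearD [::] _ _ _ mF) /=; congr (F (_ :: _)).
by case: v => x y; rewrite /inA /inB; congr (_, _); rewrite /= ?addr0 ?add0r.
Qed.

Lemma bideg_part0E F s : bideg_part 0 F s = F (map (fun v => inB A v.2) s).
Proof.
by elim: s F => //= v s IH F; rewrite add0r (IH (fun t => F (inB A v.2 :: t))).
Qed.

Lemma count_inlr (t : seq (A + B)) : (count is_inl t + count is_inr t)%N = size t.
Proof. by elim: t => //= -[x|x] t <-; rewrite /= ?addnS. Qed.

(** Q_n consists of all cochains without component in Hom(B^{n+1}, A). *)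
Lemma Q_P n F : Q_ n F <-> g_ n F /\ P F = 0.
Proof.
split=> [[c Cc ->]|[gF /P_eq0 PF0]].
  have gc i : (i <= n.+1)%N -> g_ n (c i) /\ P (c i) = 0.
    move=> le_in; have [] := Cc i le_in.
    rewrite (_ : _ + _ = n%:Z :> int); last by lia.
    move=> gci Ci; split=> //; apply/P_eq0 => s.
    have [eq_s|/(Hom_size gci)] := eqVneq (size (map (@inB K A B) s)) n.+1; last first.
      by move=> ->.
    have eqm : map (@inB K A B) s = map (@inAB K A B) (map inr s).
      by rewrite -map_comp; apply: eq_map.
    rewrite eqm; have [_ C2 C3] := Ci (map inr s).
    have c0 : count is_inl (map inr s) = 0%N by elim: (s).
    have c1 : count is_inr (map inr s) = n.+1.
      by rewrite -eq_s size_map; elim: (s) => //= x s' ->.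
    have nt1 : ~~ in_tensor (n.+1%:Z - i%:Z + 1) (i%:Z - 1) (map inr s : seq (A + B)).
      rewrite /in_tensor -/is_inl -/is_inr c0 c1; lia.
    case: (boolP (in_tensor (n.+1%:Z - i%:Z) (i%:Z - 1 + 1) (map inr s : seq (A + B)))).
      exact: C2.
    by move=> nt2; rewrite C3.
  elim/big_ind: _ => [|F1 F2 [g1 P1] [g2 P2]|i _]; last by apply: gc; rewrite -ltnS.
    by split; [exact: Hom0 | apply/P_eq0].
  have := Hom_lin 1 g1 g2; have := P_lin 1 F1 F2.
  by rewrite !scale1r P1 P2 addr0.
have mF := Hom_multilinear gF.
(* The component in C^{n+1-i|i-1} takes values in A on n + 2 - i arguments in A,
   and values in B on n + 1 - i arguments in A. *)
exists (fun i s => inA B (bideg_part (n.+2 - i) F s).1 + inB A (bideg_part (n.+1 - i) F s).2).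
  move=> i le_in; split.
    rewrite (_ : _ + _ = n%:Z :> int); last by lia.
    apply/HomP; split=> [s ne_s|s1 s2 a u v].
      rewrite !bideg_part_eq0 ?/inA ?/inB; first by congr (_, _); rewrite /= addr0.
        by move=> t eq_t; rewrite (Hom_size gF) ?eq_t.
      by move=> t eq_t; rewrite (Hom_size gF) ?eq_t.
    have mp p := bideg_part_multilinear p mF.
    by rewrite !mp /= inA_lin inB_lin scalerDr addrACA.
  move=> t; rewrite !bideg_part_pure // /in_tensor -/is_inl -/is_inr.
  have [eq_t|ne_t] := eqVneq (size t) n.+1; last first.
    have F0 : F (map (@inAB K A B) t) = 0 by rewrite (Hom_size gF) // size_map.
    by rewrite F0 !if_same /inA /inB; split=> // *; rewrite /= ?addr0 //; congr (_, _); rewrite /= addr0.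
  have cnt := count_inlr t; rewrite eq_t in cnt.
  split.
  - move=> /andP[/eqP e1 /eqP e2]; rewrite [X in inB _ X.2]ifF /= ?addr0 //.
    by apply/eqP; lia.
  - move=> /andP[/eqP e1 /eqP e2]; rewrite [X in inA _ X.1]ifF /= ?addr0 //.
    by apply/eqP; lia.
  - move=> nt1 nt2; rewrite !ifF.
    + by rewrite /inA /inB; congr (_, _); rewrite /= addr0.
    + by apply/eqP => eq1; move: nt2; apply/negP/negPn/andP; split; apply/eqP; lia.
    + by apply/eqP => eq1; move: nt1; apply/negP/negPn/andP; split; apply/eqP; lia.
apply: funext => s; rewrite fct_sumE.
have [eq_s|ne_s] := eqVneq (size s) n.+1; last first.
  rewrite (Hom_size gF ne_s) big1 // => i _.
  have F0 t : size t = size s -> F t = 0.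
    by move=> eq_t; rewrite (Hom_size gF) ?eq_t.
  by rewrite !bideg_part_eq0 // /inA /inB; congr (_, _); rewrite /= addr0.
rewrite big_split /=.
have sumA (f : nat -> A) m : \sum_(i < m) inA B (f i) = inA B (\sum_(i < m) f i).
  elim: m => [|m IHm]; first by rewrite !big_ord0.
  by rewrite !big_ord_recr /= IHm /inA; congr (_, _); rewrite /= addr0.
have sumB (f : nat -> B) m : \sum_(i < m) inB A (f i) = inB A (\sum_(i < m) f i).
  elim: m => [|m IHm]; first by rewrite !big_ord0.
  by rewrite !big_ord_recr /= IHm /inB; congr (_, _); rewrite /= addr0.
rewrite (sumA (fun i => (bideg_part (n.+2 - i) F s).1)) (sumB (fun i => (bideg_part (n.+1 - i) F s).2)).
have sum1 (f : nat -> V) m : \sum_(i < m) (f i).1 = (\sum_(i < m) f i).1.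
  by elim: m => [|m IHm]; rewrite ?big_ord0 // !big_ord_recr /= IHm.
have sum2 (f : nat -> V) m : \sum_(i < m) (f i).2 = (\sum_(i < m) f i).2.
  by elim: m => [|m IHm]; rewrite ?big_ord0 // !big_ord_recr /= IHm.
have F1 : (\sum_(i < n.+2) bideg_part (n.+2 - i) F s).1 = (F s).1.
  rewrite -(bideg_part_sum (N := n.+2) mF) ?eq_s // [in RHS]big_ord_recl.
  rewrite (reindex_inj rev_ord_inj) /= bideg_part0E.
  rewrite [X in _ = X + _](_ : _ = 0) ?add0r.
    congr (_.1); apply: eq_bigr => i _; congr (bideg_part _ _ _); have := ltn_ord i; rewrite /bump; lia.
  by rewrite -[RHS](PF0 (map snd s)) -map_comp.
have F2 : (\sum_(i < n.+2) bideg_part (n.+1 - i) F s).2 = (F s).2.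
  rewrite -(bideg_part_sum (N := n.+1) mF) ?eq_s //.
  rewrite (reindex_inj rev_ord_inj) /=.
  by congr (_.2); apply: eq_bigr => i _; congr (bideg_part _ _ _); have := ltn_ord i; lia.
rewrite (sum1 (fun i => bideg_part (n.+2 - i) F s)) (sum2 (fun i => bideg_part (n.+1 - i) F s)) F1 F2.
by rewrite [LHS]surjective_pairing /inA /inB; congr (_, _); rewrite /= ?addr0 ?add0r.
Qed.

End Bidegree.

(** * The twisted operations *)

(** A sum over a set of natural numbers whose terms vanish from N on is finite. *)
Lemma fsbig_nat (U : nmodType) (D : set nat) (t : nat -> U) N :
  (forall n, (N <= n)%N -> t n = 0) ->
  \sum_(n \in D) t n = \sum_(n < N | (n : nat) \in D) t n.
Proof.
move=> t0; rewrite fsbig_mkcond /=.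
rewrite -(fsbig_widen `I_N) //; last first.
  move=> n [_ /negP]; rewrite -leqNgt => le_Nn /=.
  by rewrite /patch t0 // if_same.
rewrite -fsbig_ord [RHS]big_mkcond; apply: eq_bigr => n _.
by rewrite /patch; case: ifP.
Qed.

Section Twisting.
Variables (K : fieldType) (A B : lmodType K).
Hypothesis charK0 : [pchar K] =i pred0.
Notation V := (A * B)%type.
Implicit Types (F G X : seq V -> V) (r : {linear B -> A}).
Notation T := (int * ((seq V -> V) * (seq V -> V)))%type.
Implicit Types (s t : seq T).

Notation H := [set F : seq V -> V | multilinear F].
Notation gZ := (Zgraded (@g_ K A B)).
Notation bZ := (Zgraded (@b_ K A B)).
Notation QZ := (Zgraded (@Q_ K A B)).
Notation br := (@bracket K V).
Notation homog := (homogeneous (@Qb K A B)).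
Notation lie := (@gerstenhaber_Lie K A B).

Lemma bZ_gZ d : bZ d `<=` gZ d.
Proof. by case: d => n; first exact: b_g. Qed.

Lemma bZ_subspace d : linear_subspace (bZ d).
Proof. by apply: Zgraded_subspace; apply: b_subspace. Qed.

Lemma bZ_br m n F G : bZ m F -> bZ n G -> br F G = 0.
Proof.
have br0 X : multilinear X -> br 0 X = 0 /\ br X 0 = 0.
  move=> mX; split.
    exact: (linear_on0 (lie_sub lie) (lie_linl lie mX)).
  exact: (linear_on0 (lie_sub lie) (lie_linr lie mX)).
move=> bF bG; have [mF mG] := (Zgraded_multilinear (bZ_gZ bF), Zgraded_multilinear (bZ_gZ bG)).
case: m bF => m bF; last by rewrite bF (br0 _ mG).1.
case: n bG => n bG; last by rewrite bG (br0 _ mF).2.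
exact: b_br bF bG.
Qed.

Lemma QZ_P d F : QZ d F <-> gZ d F /\ P F = 0.
Proof.
case: d => n; first exact: Q_P.
split=> [-> |[]//]; split=> //; exact/P_eq0.
Qed.

Lemma QZ_gZ d : QZ d `<=` gZ d. Proof. by move=> F /QZ_P[]. Qed.

Lemma QZ_subspace d : linear_subspace (QZ d).
Proof.
have [g0 glin] := Zgraded_subspace d (@g_subspace K A B).
split; first by apply/QZ_P; split=> //; apply/P_eq0.
move=> a F G /QZ_P[gF PF] /QZ_P[gG PG]; apply/QZ_P; split; first exact: glin.
by rewrite P_lin PF PG scaler0 addr0.
Qed.

Lemma QZ_br m n F G : QZ m F -> QZ n G -> QZ (m + n) (br F G).
Proof.
move=> /QZ_P[gF PF] /QZ_P[gG PG]; apply/QZ_P; split; first exact: (lie_degree lie).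
exact: P_ker.
Qed.

Lemma shear_conj_gZ r d F : gZ d F -> gZ d (shear_conj r F).
Proof.
case: d => n; first exact: shear_conj_Hom.
by move=> ->; apply: funext => s; rewrite /shear_conj shearV0.
Qed.

Lemma P_bZ d F : gZ d F -> bZ d (P F).
Proof.
case: d => n; first exact: P_b.
by move=> ->; apply/P_eq0.
Qed.

Lemma P_shear_conj_id r d F : bZ d F -> P (shear_conj r F) = F.
Proof.
case: d => n => [bF|->]; first by rewrite (shear_conj_b r bF) (P_id bF).
by apply/P_eq0 => s; rewrite /shear_conj shearV0.
Qed.

Lemma elt_bZ r : bZ 0 (elt_b r). Proof. exact: elt_b_Hom. Qed.

(** ad is nilpotent on each component, so that its exponential is finite. *)
Lemma exp_adZ r d X : gZ d X -> exists N0, forall N, (N0 <= N)%N ->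
  iter N (ad r) X = 0 /\
  \sum_(k < N) (k`!%:R : K)^-1 *: iter k (ad r) X = shear_conj r X.
Proof.
case: d => n gX.
  exists n.+3 => N le_N; split; first exact: iter_ad_eq0 gX _.
  exact: (exp_ad r charK0 gX).
have iter0 k : iter k (ad r) X = 0.
  rewrite gX; elim: k => //= k ->.
  by apply: (linear_on0 (lie_sub lie) (lie_linl lie _)); apply: Zgraded_multilinear (bZ_gZ (elt_bZ r)).
exists 0%N => N _; split=> //.
rewrite big1 => [|k _]; last by rewrite iter0 scaler0.
by rewrite gX; apply/esym/funext => s; rewrite /shear_conj shearV0.
Qed.

(* The part of total_br due to the entries of s, without the contribution of
   the twisting element. *)
Notation total_br0 := (total_br br 0).

Lemma sum_br (I : Type) (idx : seq I) (c : I -> K) (Y : I -> seq V -> V) Z :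
  (forall i, multilinear (Y i)) -> multilinear Z ->
  br (\sum_(i <- idx) c i *: Y i) Z = \sum_(i <- idx) c i *: br (Y i) Z.
Proof.
move=> mY mZ; elim: idx => [|i idx IH].
  by rewrite !big_nil; apply: (linear_on0 (lie_sub lie) (lie_linl lie mZ)).
by rewrite !big_cons bracket_linl // IH.
Qed.

(** The component of ltilde in b, before projection. *)
Lemma ltilde_sum s : homog s ->
  \sum_(i < size s) ((-1) ^ ((s`_i).1 * degree (take i s)) : K) *:
     iter_br br (s`_i).2.1 (take i s ++ drop i.+1 s) = total_br0 s.
Proof.
elim: s => [|x s IH]; first by rewrite big_ord0.
move=> Gs; have [Gx Gs'] := (homogeneous_cons _ _ _).1 Gs.
rewrite /= -(IH Gs') big_ord_recl /= degree_nil mulr0 expr0z scale1r drop0 addrC.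
congr (_ + _).
have Gi i : (i < size s)%N -> Qb (s`_i).1 (s`_i).2.
  by move=> lti; apply: Gs'; apply: mem_nth.
have split_s i : (i < size s)%N -> homog (take i s ++ drop i.+1 s) /\
    degree s = (s`_i).1 + degree (take i s ++ drop i.+1 s).
  move=> lti; have eqs : s = take i s ++ s`_i :: drop i.+1 s.
    by rewrite -drop_nth // cat_take_drop.
  split; last by rewrite {1}eqs !degree_cat degree_cons addrCA.
  move: Gs'; rewrite {1}eqs => /homogeneous_cat[G1 /homogeneous_cons[_ G2]].
  exact/homogeneous_cat.
have mf : multilinear x.2.2 by case: Gx => _ /bZ_gZ/Zgraded_multilinear.
rewrite sum_br //; last first.
  move=> i; have [Q_i _] := Gi _ (ltn_ord i); have [Gr _] := split_s _ (ltn_ord i).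
  apply: (iter_br_H lie bZ_gZ) Gr; exact: Zgraded_multilinear (QZ_gZ Q_i).
rewrite scaler_sumr; apply: eq_bigr => i _.
have [Q_i _] := Gi _ (ltn_ord i); have [Gr ds] := split_s _ (ltn_ord i).
have Gxr : homog (x :: (take i s ++ drop i.+1 s)) by apply/homogeneous_cons.
rewrite (iter_br_cons_last lie bZ_gZ bZ_br (QZ_gZ Q_i) Gxr) !scalerA degree_cons ds.
by congr (_ *: _); sign_ring.
Qed.

Lemma ltilde2 s : homog s -> (ltilde s).2 = P (total_br0 s).
Proof.
move=> Gs; rewrite -(ltilde_sum Gs) /ltilde /=.
have sumP (I : Type) (idx : seq I) (c : I -> K) (Y : I -> seq V -> V) :
    P (\sum_(i <- idx) c i *: Y i) = \sum_(i <- idx) c i *: P (Y i).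
  elim: idx => [|i idx IH]; first by rewrite !big_nil; apply/P_eq0.
  by rewrite !big_cons P_lin IH.
rewrite sumP; case: ltnP => // lt_s.
case: s Gs lt_s => [|x [|y s]] // Gs _; first by rewrite big_ord0.
have [[/QZ_P[_ PF] _] _] := (homogeneous_cons _ _ _).1 Gs.
by rewrite big_ord_recl big_ord0 /= [iter_br _ _ _]/= PF scaler0 addr0.
Qed.

Section Twist.
Variables (Om : seq V -> V) (r : {linear B -> A}).
Hypothesis Om_Q : QZ 1 Om.

Notation alpha := (Om, elt_b r).

Lemma alpha_Qb : Qb 0 alpha. Proof. by split; last exact: elt_bZ. Qed.

Lemma homogeneous_nseq n s : homog s -> homog (nseq n (0, alpha) ++ s).
Proof.
by move=> Gs; elim: n => //= n IH; apply/homogeneous_cons; split; first exact: alpha_Qb.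
Qed.

Lemma iter_ad_gZ n d X : gZ d X -> gZ d (iter n (ad r) X).
Proof.
move=> gX; elim: n => //= n IH; rewrite -[d]addr0.
by apply: (lie_degree lie) IH (bZ_gZ (elt_bZ r)).
Qed.

Lemma iter_br_nseq n d X s : gZ d X -> homog s ->
  iter_br br X (nseq n (0, alpha) ++ s) = iter n (ad r) (iter_br br X s).
Proof.
move=> gX Gs; elim: n => //= n <-.
have Gn : homog ((0 : int, alpha) :: nseq n (0 : int, alpha) ++ s).
  by apply/homogeneous_cons; split; [exact: alpha_Qb|exact: homogeneous_nseq].
by rewrite (iter_br_cons_last lie bZ_gZ bZ_br gX Gn) mul0r expr0z scale1r.
Qed.

Lemma total_br0_g s : homog s -> gZ (degree s + 1) (total_br0 s).
Proof.
by apply: (total_br_g lie QZ_gZ bZ_gZ); apply: subspace0; apply: QZ_subspace.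
Qed.

Lemma iter_br_Om_g s : homog s -> gZ (degree s + 1) (iter_br br Om s).
Proof. by rewrite addrC; apply: (iter_br_g lie bZ_gZ); apply: QZ_gZ. Qed.

(** With n additional entries (Om, r) in front, either all of them act through
    r on the other entries, or one of the n acts through Om. *)
Lemma total_br0_nseq n s : homog s ->
  total_br0 (nseq n (0, alpha) ++ s)
  = iter n (ad r) (total_br0 s) + iter n.-1 (ad r) (iter_br br Om s) *+ n.
Proof.
move=> Gs; have mr := Zgraded_multilinear (bZ_gZ (elt_bZ r)).
have mM k := Zgraded_multilinear (iter_ad_gZ k (total_br0_g Gs)).
have mP k := Zgraded_multilinear (iter_ad_gZ k (iter_br_Om_g Gs)).
elim: n => [|n IH]; first by rewrite mulr0n addr0.
rewrite [nseq _ _ ++ _]/= [LHS]/= mul0r expr0z scale1r.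
rewrite (iter_br_nseq n (QZ_gZ Om_Q) Gs) IH -scaler_nat.
rewrite (brDl lie) ?(brZl lie) //; try exact: mM; try exact: mP; last first.
  by apply: (subspaceZ (lie_sub lie)); apply: mP.
rewrite scaler_nat -addrA [iter n.+1 _ _ in RHS]/=; congr (_ + _).
by case: n {IH} => [|n]; rewrite ?mulr0n ?add0r ?mulr1n // -mulrSr.
Qed.

Lemma total_br_split s : homog s -> total_br br Om s = total_br0 s + iter_br br Om s.
Proof.
elim: s => [|x s IH]; first by rewrite /= add0r.
move=> Gs; have [[Qx bx] Gs'] := (homogeneous_cons _ _ _).1 Gs.
have mf := Zgraded_multilinear (bZ_gZ bx).
have mM := Zgraded_multilinear (total_br0_g Gs').
have mP := Zgraded_multilinear (iter_br_Om_g Gs').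
rewrite [LHS]/= (IH Gs') (iter_br_cons_last lie bZ_gZ bZ_br (QZ_gZ Om_Q) Gs) (brDl lie) //.
by rewrite [total_br br 0 _]/= scalerDr addrAC.
Qed.

(** The exponential sum of the previous expressions. The factor n turns 1/n!
    into 1/(n-1)!. *)
Lemma sum_exp d Z Y : gZ d Z -> gZ d Y -> exists N0, forall N, (N0 <= N)%N ->
  iter N (ad r) Z + iter N.-1 (ad r) Y *+ N = 0 /\
  \sum_(n < N) (n`!%:R : K)^-1 *: (iter n (ad r) Z + iter n.-1 (ad r) Y *+ n)
  = shear_conj r (Z + Y).
Proof.
move=> gZ_ gY; have [N1 E1] := exp_adZ r gZ_; have [N2 E2] := exp_adZ r gY.
exists (N1 + N2).+1 => -[//|N] le_N.
have [le1 le2] : (N1 <= N)%N /\ (N2 <= N)%N by split; lia.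
split; first by rewrite (E1 _ (leqW le1)).1 (E2 _ le2).1 mul0rn addr0.
under eq_bigr do rewrite scalerDr.
rewrite big_split /= (E1 _ (leqW le1)).2.
rewrite (sum_invfact_pred charK0 N (fun n => iter n (ad r) Y)) (E2 _ le2).2.
by have := shear_conj_lin r 1 Z Y; rewrite !scale1r => ->.
Qed.

Lemma ltilde1_eq0 s : (2 < size s)%N -> (ltilde s).1 = 0.
Proof. by case: s => [|x [|y [|z s]]]. Qed.

Lemma sum_pair (U W : nmodType) N (t : nat -> U * W) :
  \sum_(n < N) t n = (\sum_(n < N) (t n).1, \sum_(n < N) (t n).2).
Proof.
elim: N => [|N IH]; first by rewrite !big_ord0.
by rewrite !big_ord_recr /= IH; case: (t N).
Qed.

(** The operations twisted by (Om, r) are the higher derived brackets of Om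
    for the projection P o exp(ad r). *)
Lemma twistE s : (0 < size s)%N -> homog s ->
  twist (@ltilde K A B) alpha s = derived_op br (fun X => P (shear_conj r X)) Om s.
Proof.
move=> s_gt0 Gs; have [N0 EN] := sum_exp (total_br0_g Gs) (iter_br_Om_g Gs).
have U2 n : (ltilde (nseq n (0 : int, alpha) ++ s)).2
    = P (iter n (ad r) (total_br0 s) + iter n.-1 (ad r) (iter_br br Om s) *+ n).
  by rewrite ltilde2 ?total_br0_nseq //; apply: homogeneous_nseq.
have P0 : P (0 : seq V -> V) = 0 by apply/P_eq0.
(* At least three terms, so that the component in Q, which involves lists of
   size two only, is complete. *)
pose N := (N0 + 3)%N.
rewrite /twist (@fsbig_nat _ _ _ N); last first.
  move=> n le_Nn; rewrite [ltilde _]surjective_pairing U2 (EN n _).1; last by lia.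
  rewrite P0 ltilde1_eq0 ?scaler0 // size_cat size_nseq; lia.
under eq_bigl do rewrite in_setT.
rewrite (sum_pair N (fun n => (n`!%:R : K)^-1 *: ltilde (nseq n (0 : int, alpha) ++ s))).
congr (_, _); last first.
  rewrite (total_br_split Gs) /= -(EN N _).2; last by lia.
  have sumP (f : nat -> seq V -> V) m :
      \sum_(n < m) (n`!%:R : K)^-1 *: P (f n) = P (\sum_(n < m) (n`!%:R : K)^-1 *: f n).
    elim: m => [|m IHm]; first by rewrite !big_ord0 P0.
    by rewrite !big_ord_recr /= IHm addrC -P_lin addrC.
  rewrite -(sumP (fun n => iter n (ad r) (total_br0 s) + iter n.-1 (ad r) (iter_br br Om s) *+ n)).
  by apply: eq_bigr => n _; rewrite -U2.
rewrite /N addnC !add3n !big_ord_recl big1 => [|n _]; last first.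
  rewrite (_ : (_ *: _).1 = ((n.+3)`!%:R : K)^-1 *: (ltilde (nseq n.+3 (0 : int, alpha) ++ s)).1) //.
  by rewrite ltilde1_eq0 ?scaler0 // size_cat size_nseq.
case: s s_gt0 Gs {EN U2} => [//|x [|y [|z s]]] _ Gs; rewrite /= ?scaler0 ?addr0 ?add0r //.
- by rewrite invr1 scale1r expr1z scaleN1r.
- by rewrite invr1 scale1r.
Qed.

End Twist.
End Twisting.

(** * Maurer-Cartan elements *)

Section Characterizations.
Variables (K : fieldType) (A B : lmodType K).
Hypothesis charK0 : [pchar K] =i pred0.
Notation V := (A * B)%type.
Implicit Types (F G X : seq V -> V) (r : {linear B -> A}).
Notation gZ := (Zgraded (@g_ K A B)).
Notation bZ := (Zgraded (@b_ K A B)).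
Notation QZ := (Zgraded (@Q_ K A B)).
Notation br := (@bracket K V).
Notation lie := (@gerstenhaber_Lie K A B).

Lemma two_neq0 : (2 : K) != 0.
Proof. by rewrite ((pcharf0P K).1 charK0). Qed.

Lemma Zgraded_g_independent (D : seq int) (x : int -> seq V -> V) : uniq D ->
  (forall d, d \in D -> gZ d (x d)) -> \sum_(d <- D) x d = 0 ->
  forall d, d \in D -> x d = 0.
Proof.
move=> uD gx sum0 [n|n] dD; last exact: (gx _ dD).
have gn : g_ n (x n) := gx _ dD.
apply: funext => s; have [eq_s|] := eqVneq (size s) n.+1; last exact: (Hom_size gn).
have := congr1 (fun f : seq V -> V => f s) sum0.
rewrite fct_sumE (bigD1_seq (Posz n)) //= big1_seq ?addr0 // => d /andP[ne_d dD'].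
case: d ne_d dD' => m ne_m mD; last by rewrite (gx _ mD).
apply: (Hom_size (gx _ mD)); rewrite eq_s eqSS eq_sym.
by apply: contra ne_m => /eqP ->.
Qed.

Lemma Qb_graded : graded_space (@Qb K A B).
Proof.
split.
- by move=> d; split; [have /subspace0 := @QZ_subspace K A B (d + 1)
    | have /subspace0 := @bZ_subspace K A B d].
- move=> d a x y [Qx bx] [Qy By].
  by split; [case: (@QZ_subspace K A B (d + 1)) | case: (@bZ_subspace K A B d)] => _; apply.
move=> D x uD Gx sum0 d dD.
have sum1 : \sum_(d <- D) (x d).1 = 0 /\ \sum_(d <- D) (x d).2 = 0.
  by split; [rewrite -(raddf_sum fst) sum0 | rewrite -(raddf_sum snd) sum0].
have x2 : (x d).2 = 0.
  apply: (Zgraded_g_independent uD _ sum1.2 dD) => e eD.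
  by have [_] := Gx e eD; apply: bZ_gZ.
have x1 : (x d).1 = 0.
  have uD' : uniq [seq e + 1 | e <- D] by rewrite map_inj_uniq //; apply: addIr.
  have := @Zgraded_g_independent _ (fun e => (x (e - 1)).1) uD'.
  rewrite big_map; under eq_bigr do rewrite addrK.
  move=> ind; have := ind _ sum1.1 (d + 1); rewrite addrK; apply.
    move=> _ /mapP[e eD ->]; rewrite addrK.
    by have [] := Gx e eD => Qe _; apply: QZ_gZ.
  by apply: map_f.
by rewrite [x d]surjective_pairing x1 x2.
Qed.

(** [X, X] is twice the associator of X. *)
Lemma bracket_associative X : g_ 1 X ->
  (br X X = 0 <-> forall u v w, X [:: X [:: u; v]; w] = X [:: u; X [:: v; w]]).
Proof.
move=> gX; have brE u v w : br X X [:: u; v; w]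
    = 2 *: (X [:: X [:: u; v]; w] - X [:: u; X [:: v; w]]).
  rewrite (bracket_Hom gX gX) add_funE opp_funE scale_funE /ins /cut3 /=.
  have X1 x : X [:: x] = 0 by apply: (Hom_size gX).
  have X3 x y z : X [:: x; y; z] = 0 by apply: (Hom_size gX).
  have X4 x y z t : X [:: x; y; z; t] = 0 by apply: (Hom_size gX).
  rewrite !X4 !X3 !X1 /block_sign !mul0n !mul1n.
  by lmod_coefs K; ring.
split=> [X0 u v w|assocX].
  have /eqP := brE u v w; rewrite X0 eq_sym scaler_eq0 (negPf two_neq0) subr_eq0 /=.
  by move/eqP.
apply: funext => s; have [|ne_s] := eqVneq (size s) 3; last first.
  exact: (Hom_size (bracket_degree gX gX)).
by case: s => [|u [|v [|w []]]] // _; rewrite brE assocX subrr scaler0.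
Qed.

(** For arguments x and y in B, exp(- r) X (r x + x, r y + y) has as component in
    A the defect of r to be a weak deformation map; the component of X(x, y) in
    A, absent from that condition, vanishes. *)
Lemma shear_conj_deformation r X : Q_ 1 X ->
  (P (shear_conj r X) = 0 <-> weak_deformation_map X r).
Proof.
move=> /Q_P[gX /P_eq0 PX]; have mX := Hom_multilinear gX.
have conjE x y : (shear_conj r X [:: inB A x; inB A y]).1
    = Defs.mulA X (r x) (r y) + lharp X (r x) y + rharp X x (r y)
      - r (mulB X x y + rtri X (r x) y + ltri X x (r y) + theta X (r x) (r y)).
  rewrite /shear_conj /shearV /shear /=.
  have split_sh (z : B) : (0 + r z, z) = inA B (r z) + inB A z :> V.
    by rewrite /inA /inB; congr (_, _); rewrite /= ?add0r ?addr0.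
  rewrite !split_sh (multilinearD [::] _ _ _ mX) !(multilinearD [:: _] [::] _ _ mX).
  have PXxy : (X [:: inB A x; inB A y]).1 = 0 by have := PX [:: x; y].
  rewrite /= PXxy /Defs.mulA /lharp /rharp /mulB /rtri /ltri /theta.
  by rewrite !linearD /=; lmod_coefs K; ring.
split=> [/P_eq0 X0 x y|defX].
  by apply/eqP; rewrite -subr_eq0 -conjE (X0 [:: x; y]).
apply/P_eq0 => s; have [|ne_s] := eqVneq (size s) 2; last first.
  by rewrite (Hom_size (shear_conj_Hom r gX)) // size_map.
by case: s => [|x [|y []]] // _; rewrite conjE defX subrr.
Qed.

Lemma quasi_twilledP X :
  quasi_twilled X <-> Q_ 1 X /\ br X X = 0.
Proof.
split=> [[gX assocX subX]|[QX X0]].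
  split; last by apply/bracket_associative.
  apply/Q_P; split=> //; apply/P_eq0 => s.
  have [|ne_s] := eqVneq (size s) 2; last by rewrite (Hom_size gX) // size_map.
  case: s => [|x [|y []]] // _ /=; by have [z ->] := subX x y.
have [gX /P_eq0 PX] := (Q_P _ _).1 QX.
split=> //; first exact/bracket_associative.
move=> x y; exists (X [:: inB A x; inB A y]).2.
by rewrite [LHS]surjective_pairing (PX [:: x; y]).
Qed.

End Characterizations.

Section MaurerCartan.
Variables (K : fieldType) (A B : lmodType K).
Hypothesis charK0 : [pchar K] =i pred0.
Notation V := (A * B)%type.
Variables (Om : seq V -> V) (r : {linear B -> A}).
Hypothesis HOm : quasi_twilled Om.
Hypothesis Hr : weak_deformation_map Om r.
Notation gZ := (Zgraded (@g_ K A B)).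
Notation bZ := (Zgraded (@b_ K A B)).
Notation QZ := (Zgraded (@Q_ K A B)).
Notation br := (@bracket K V).
Notation lie := (@gerstenhaber_Lie K A B).
Notation l := (twist (@ltilde K A B) (Om, elt_b r)).

Let Om_Q : Q_ 1 Om. Proof. by case: ((quasi_twilledP charK0 Om).1 HOm). Qed.
Let OmOm : br Om Om = 0. Proof. by case: ((quasi_twilledP charK0 Om).1 HOm). Qed.
Let P_Om : P (shear_conj r Om) = 0. Proof. exact/shear_conj_deformation. Qed.

Lemma twisted_Linfty : Linfty_algebra (@Qb K A B) l.
Proof.
apply: (@derived_op_Linfty K (seq V -> V) [set F | multilinear F] gZ QZ bZ br
  (fun X => P (shear_conj r X)) Om (two_neq0 charK0) lie) => //.
- exact: QZ_subspace.
- exact: QZ_gZ.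
- exact: QZ_br.
- exact: bZ_subspace.
- exact: bZ_gZ.
- exact: bZ_br.
- by move=> a F G _ _; rewrite shear_conj_lin P_lin.
- by move=> d F gF; apply/P_bZ/shear_conj_gZ.
- by move=> d F; apply: P_shear_conj_id.
- by move=> m n F G gF gG PF PG; rewrite shear_conj_bracket; apply: P_ker.
- exact: Qb_graded.
- by move=> s s_gt0 Gs; apply: twistE.
Qed.

Lemma Q_D n (F G : seq V -> V) : Q_ n F -> Q_ n G -> Q_ n (F + G).
Proof.
by move=> QF QG; apply: (subspaceD (@QZ_subspace K A B n)).
Qed.

(** The left-hand side of the Maurer-Cartan equation. In the b-component, the
    term for k = 0 would be P (exp(ad r) Om) = 0, so it can be added. *)
Lemma maurer_cartan_sum (Om' : seq V -> V) (r' : {linear B -> A}) : Q_ 1 Om' ->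
  \sum_(k \in [set k | (0 < k)%N]) (k`!%:R : K)^-1 *: l (nseq k (0, (Om', elt_b r')))
  = (- (br Om Om' + (2%:R : K)^-1 *: br Om' Om'),
     P (shear_conj r (shear_conj r' (Om + Om')))).
Proof.
move=> QOm'; pose U k := iter k (ad r') Om + iter k.-1 (ad r') Om' *+ k.
have gOm : gZ 1 Om := QZ_gZ (Om_Q : QZ 1 Om).
have gOm' : gZ 1 Om' := QZ_gZ (QOm' : QZ 1 Om').
have lE k : (0 < k)%N -> l (nseq k (0, (Om', elt_b r')))
    = (Q_part br Om (nseq k (0 : int, (Om', elt_b r'))), P (shear_conj r (U k))).
  move=> k_gt0; have Gnil := @homogeneous_nil K _ (@Qb K A B).
  have Gk := homogeneous_nseq (r := r') (n := k) (QOm' : QZ 1 Om') Gnil.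
  rewrite -[nseq k _]cats0 twistE //; last by rewrite size_cat size_nseq addn0.
  rewrite /derived_op (total_br_split (Om_Q : QZ 1 Om) Gk).
  rewrite (total_br0_nseq r' (QOm' : QZ 1 Om') k Gnil) (iter_br_nseq r' (QOm' : QZ 1 Om') k gOm Gnil).
  congr (_, P (shear_conj r _)); rewrite /= /U addrC.
  have -> : iter k (ad r') (0 : seq V -> V) = 0; last by rewrite add0r.
  elim: k {k_gt0 Gk} => //= k ->.
  by apply: (linear_on0 (lie_sub lie) (lie_linl lie _)); apply: Zgraded_multilinear (bZ_gZ (elt_bZ r')).
have [N0 EN] := sum_exp charK0 r' gOm gOm'.
have P0 : P (shear_conj r (0 : seq V -> V)) = 0.
  by apply/P_eq0 => s; rewrite /shear_conj shearV0.
pose N := (N0 + 3)%N.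
rewrite (@fsbig_nat _ _ _ N); last first.
  move=> n le_Nn; rewrite lE; last by lia.
  have -> : U n = 0 by apply: (EN n _).1; lia.
  rewrite P0.
  have : (2 < n)%N by lia.
  by case: n {le_Nn} => [|[|[|n]]] // _; rewrite /= scaler0.
have -> : \sum_(k < N | (k : nat) \in [set k | (0 < k)%N])
      (k`!%:R : K)^-1 *: l (nseq k (0, (Om', elt_b r')))
    = \sum_(k < N) (k`!%:R : K)^-1 *:
      (Q_part br Om (nseq k (0 : int, (Om', elt_b r'))), P (shear_conj r (U k))).
  rewrite big_mkcond; apply: eq_bigr => -[[|k] ltk] _ /=.
    rewrite ifF; first by rewrite /U mulr0n addr0 P_Om [RHS]scaler0.
    by apply/negbTE; rewrite notin_setE.
  have k_in : k.+1 \in [set k : nat | (0 < k)%N] by rewrite inE.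
  by rewrite k_in (lE k.+1).
rewrite (sum_pair N (fun k => (k`!%:R : K)^-1 *:
   (Q_part br Om (nseq k (0 : int, (Om', elt_b r'))), P (shear_conj r (U k))))).
congr (_, _); last first.
  rewrite -(EN N _).2; last by lia.
  have sumP (f : nat -> seq V -> V) m :
      \sum_(n < m) (n`!%:R : K)^-1 *: P (shear_conj r (f n))
      = P (shear_conj r (\sum_(n < m) (n`!%:R : K)^-1 *: f n)).
    elim: m => [|m IHm]; first by rewrite !big_ord0 P0.
    by rewrite !big_ord_recr /= IHm addrC -P_lin -shear_conj_lin addrC.
  exact: (sumP U).
rewrite /N addnC !add3n !big_ord_recl big1 => [|n _]; last by rewrite /= scaler0.
rewrite /= scaler0 addr0 add0r invr1 scale1r expr1z.
by rewrite scaleN1r scalerN -opprD.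
Qed.

Theorem twisted_maurer_cartan (Om' : seq V -> V) (r' : {linear B -> A}) :
  Q_ 1 Om' ->
  (quasi_twilled (Om + Om') /\ weak_deformation_map (Om + Om') (r \+ r'))
  <-> maurer_cartan (@Qb K A B) l (Om', elt_b r').
Proof.
move=> QOm'; have QD := Q_D Om_Q QOm'; have [gOm _] := (Q_P _ _).1 Om_Q.
have [gOm' _] := (Q_P _ _).1 QOm'.
have [mOm mOm'] := (Hom_multilinear gOm, Hom_multilinear gOm').
have brD : br (Om + Om') (Om + Om') = 2 *: (br Om Om' + (2%:R : K)^-1 *: br Om' Om').
  have mD := Hom_multilinear ((Q_P _ _).1 QD).1.
  rewrite (brDl lie mOm mOm' mD) (brDr lie mOm mOm' mOm) (brDr lie mOm mOm' mOm') OmOm.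
  rewrite (bracket_anti gOm' gOm) muln1 scalerDr scalerA mulfV ?two_neq0 //.
  by lmod_coefs K; ring.
rewrite /maurer_cartan (maurer_cartan_sum _ QOm') shear_conj_comp.
have Qb0 : Qb 0 (Om', elt_b r') by split; last exact: elt_bZ.
split=> [[/(quasi_twilledP charK0)[_]]|[_ [/eqP]]].
  rewrite brD => /eqP; rewrite scaler_eq0 (negPf (two_neq0 charK0)) /= => /eqP -> defD.
  split=> //; rewrite oppr0; congr (_, _).
  exact/(shear_conj_deformation _ QD).
rewrite oppr_eq0 => /eqP sum0 /(shear_conj_deformation _ QD) defD; split=> //.
by apply/(quasi_twilledP charK0); split=> //; rewrite brD sum0 scaler0.
Qed.

End MaurerCartan.

(** * The twisted structure and its Maurer-Cartan elements *)

Theorem theorem7p7 (K : fieldType) (charK0 : [pchar K] =i pred0)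
    (A B : lmodType K)
    (Omega : seq (A * B) -> A * B) (r : {linear B -> A})
    (HOmega : quasi_twilled Omega) (Hr : weak_deformation_map Omega r) :
  let l := twist (@ltilde K A B) (Omega, elt_b r) in
  Linfty_algebra (@Qb K A B) l /\
  (forall (Omega' : seq (A * B) -> A * B) (r' : {linear B -> A}),
     Q_ 1 Omega' ->
     (quasi_twilled (Omega + Omega') /\
      weak_deformation_map (Omega + Omega') (r \+ r'))
     <-> maurer_cartan (@Qb K A B) l (Omega', elt_b r')).
Proof.
move=> l; split; first exact: twisted_Linfty.
by move=> Omega' r' QOmega'; apply: twisted_maurer_cartan.
Qed.
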